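(* Let $d\ge1$ and $C_{DG}^+\ge 1$. There exists a constant $C>0$, depending only on $d$ and $C_{DG}^+$, such that for any $S\in L^\infty(B_1)$ and any $u\in \mathrm{DG}^+(B_1,S)$ (with constant $C_{DG}^+$), $$\|u_+\|_{L^\infty(B_{3/4})}\le C\left(\|u_+\|_{L^2(B_1)}+\|S\|_{L^\infty(B_1)}\right).$$
   Context: $B_r(x_0)$ is the open ball of $\mathbb{R}^d$ of radius $r$ centered at $x_0$, $B_r=B_r(0)$; $a_+=\max(a,0)$, $a_-=\max(-a,0)$. Elliptic De Giorgi class: let $B$ be an open ball of $\mathbb{R}^d$ and $S\in L^2(B)$. A function $u:B\to\mathbb{R}$ belongs to $\mathrm{DG}^+(B,S)$ with constant $C_{DG}^+\ge1$ if $u\in H^1(B)$ and for every ball $B_R(x_0)\subset B$, every $\kappa\in\mathbb{R}$ and every $r\in(0,R)$, $$\int_{B_r(x_0)}|\nabla_x(u-\kappa)_+|^2\,dx\le\frac{C_{DG}^+}{(R-r)^2}\int_{B_R(x_0)}(u-\kappa)_+^2\,dx+C_{DG}^+\int_{B_R(x_0)}|S|(u-\kappa)_+\,dx.$$ *)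

(* Defs.v *)
From HB Require Import structures.
From mathcomp Require Import all_boot all_order all_algebra.
From mathcomp Require Import all_classical all_reals all_analysis.

Set Implicit Arguments.
Unset Strict Implicit.
Unset Printing Implicit Defensive.

Import Order.TTheory GRing.Theory Num.Theory.
Import numFieldNormedType.Exports.

Local Open Scope classical_set_scope.
Local Open Scope ring_scope.

(* ['rV[R]_n] carries the sigma-algebra generated by the coordinates, which is
   the Borel one.  Every Lebesgue measurable function agrees almost everywhere
   with a Borel one, so it suffices for functions taken up to null sets. *)
Definition rV_display : measure_display. Proof. exact. Qed.

Section rV_measurable.
Context {R : realType} {n : nat}.

Let coor (i : 'I_n) (x : 'rV[R]_n) : measurableTypeR R := x ord0 i.

Let rV_set0 : g_sigma_preimage coor set0.
Proof. exact: sigma_algebra0. Qed.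

Let rV_setC A : g_sigma_preimage coor A -> g_sigma_preimage coor (~` A).
Proof. exact: sigma_algebraC. Qed.

Let rV_bigcup (F : _^nat) : (forall i, g_sigma_preimage coor (F i)) ->
  g_sigma_preimage coor (\bigcup_i F i).
Proof. exact: sigma_algebra_bigcup. Qed.

HB.instance Definition _ := @isMeasurable.Build rV_display
  'rV[R]_n (g_sigma_preimage coor) rV_set0 rV_setC rV_bigcup.

Lemma measurable_coord (i : 'I_n) :
  measurable_fun [set: 'rV[R]_n] (fun x : 'rV[R]_n => x ord0 i : measurableTypeR R).
Proof.
move=> _ Y mY; rewrite setTI; apply: sub_sigma_algebra => /=.
rewrite -bigcup_seq/=; exists i => /=; first by rewrite mem_index_enum.
by exists Y => //; rewrite setTI.
Qed.

Lemma measurable_fun_coordP d (T : measurableType d) (f : T -> 'rV[R]_n) :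
  (forall i, measurable_fun [set: T] (fun x => f x ord0 i : measurableTypeR R)) ->
  measurable_fun [set: T] f.
Proof.
move=> mf _ A mA; rewrite setTI; move: A mA.
suff: g_sigma_preimage coor `<=` [set A | measurable (f @^-1` A)] by [].
apply: smallest_sub.
  split => /=; first by rewrite preimage_set0.
  - by move=> A; rewrite setTD preimage_setC => ?; exact: measurableC.
  - by move=> F mF; rewrite preimage_bigcup; exact: bigcup_measurable.
rewrite -bigcup_seq/=; apply: bigcup_sub => i _ _ [B mB <-] /=.
by have := mf i measurableT B mB; rewrite !setTI.
Qed.

End rV_measurable.


Section rV_cons.
Context {R : realType} {n : nat}.

Definition rV_cons (p : measurableTypeR R * 'rV[R]_n) : 'rV[R]_n.+1 :=
  row_mx (const_mx p.1 : 'rV[R]_1) p.2.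

Definition rV_uncons (x : 'rV[R]_n.+1) : measurableTypeR R * 'rV[R]_n :=
  (x ord0 ord0, \row_j x ord0 (lift ord0 j)).

Lemma rV_cons0 p : rV_cons p ord0 ord0 = p.1.
Proof.
rewrite (_ : ord0 = lshift n (ord0 : 'I_1) :> 'I_(1 + n)); last exact: val_inj.
by apply: etrans (row_mxEl _ _ _ _) _; rewrite mxE.
Qed.

Lemma rV_consS p j : rV_cons p ord0 (lift ord0 j) = p.2 ord0 j.
Proof.
rewrite (_ : lift ord0 j = rshift 1 j :> 'I_(1 + n)); last exact: val_inj.
exact: row_mxEr.
Qed.

Lemma rV_consK : cancel rV_cons rV_uncons.
Proof.
move=> [a y]; rewrite /rV_uncons rV_cons0; congr pair.
by apply/rowP => j; rewrite mxE rV_consS.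
Qed.

Lemma measurable_rV_cons : measurable_fun setT rV_cons.
Proof.
apply: measurable_fun_coordP => i.
have [j ->|->] := unliftP ord0 i.
  rewrite [X in measurable_fun _ X](_ : _ =
      (fun x : 'rV[R]_n => x ord0 j) \o snd).
    exact: measurableT_comp (measurable_coord j) measurable_snd.
  by apply/funext => p; exact: rV_consS.
rewrite [X in measurable_fun _ X](_ : _ = fst); first exact: measurable_fst.
by apply/funext => p; exact: rV_cons0.
Qed.

Lemma measurable_rV_uncons : measurable_fun setT rV_uncons.
Proof.
apply: measurable_fun_pair; first exact: measurable_coord.
apply: measurable_fun_coordP => i.
rewrite [X in measurable_fun _ X](_ : _ =
    fun x : 'rV[R]_n.+1 => x ord0 (lift ord0 i)).
  exact: measurable_coord.
by apply/funext => x; rewrite mxE.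
Qed.

End rV_cons.

Section lebesgue_rV_succ.
Context {R : realType} {n : nat}.
Variable mu : {sigma_finite_measure set 'rV[R]_n -> \bar R}.

Definition lebesgue_rV_succ : set 'rV[R]_n.+1 -> \bar R :=
  pushforward (lebesgue_measure \x mu)%E rV_cons.

Let preim_measurable A : measurable A ->
  measurable (@rV_cons R n @^-1` A).
Proof. by move=> mA; rewrite -[X in measurable X]setTI; exact: measurable_rV_cons. Qed.

Let succ0 : lebesgue_rV_succ set0 = 0%E.
Proof. by rewrite /lebesgue_rV_succ /pushforward preimage_set0 measure0. Qed.

Let succ_ge0 A : (0 <= lebesgue_rV_succ A)%E.
Proof. exact: (measure_ge0 (lebesgue_measure \x mu)%E). Qed.

Let succ_sigma_additive : semi_sigma_additive lebesgue_rV_succ.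
Proof.
move=> F mF tF mUF; rewrite /lebesgue_rV_succ /pushforward preimage_bigcup.
apply: measure_semi_sigma_additive.
- by move=> k; exact: preim_measurable.
- apply/trivIsetP => i j _ _ ij; rewrite -preimage_setI.
  by move/trivIsetP : tF => /(_ _ _ _ _ ij) ->//; rewrite preimage_set0.
- by rewrite -preimage_bigcup; exact: preim_measurable.
Qed.

HB.instance Definition _ := isMeasure.Build _ _ _ lebesgue_rV_succ
  succ0 succ_ge0 succ_sigma_additive.

Let succ_sigma_finite : sigma_finite setT lebesgue_rV_succ.
Proof.
have /sigma_finiteP[F [TF ndF Foo]] :=
  sigma_finiteT (@lebesgue_measure R : {sigma_finite_measure set _ -> \bar R}).
have /sigma_finiteP[G [TG ndG Goo]] := sigma_finiteT mu.
exists (fun k => @rV_uncons R n @^-1` (F k `*` G k)).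
  apply/seteqP; split => // x _.
  have : [set: measurableTypeR R] (x ord0 ord0) by [].
  have : [set: 'rV[R]_n] (\row_j x ord0 (lift ord0 j)) by [].
  rewrite TF TG => -[k _ Gk] [j _ Fj]; exists (maxn j k) => //; split.
  - by move: Fj; exact/subsetPset/ndF/leq_maxl.
  - by move: Gk; exact/subsetPset/ndG/leq_maxr.
move=> k; have [mF Fk] := Foo k; have [mG Gk] := Goo k; split.
  rewrite -[X in measurable X]setTI; apply: measurable_rV_uncons => //.
  exact: measurableX.
rewrite /lebesgue_rV_succ /pushforward -comp_preimage.
rewrite (_ : rV_uncons \o rV_cons = id); last exact/funext/rV_consK.
by rewrite preimage_id product_measure1E// lte_mul_pinfty// ge0_fin_numE.
Qed.

HB.instance Definition _ := @Measure_isSigmaFinite.Build _ _ _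
  lebesgue_rV_succ succ_sigma_finite.

End lebesgue_rV_succ.

(* The n-fold product of the Lebesgue measure of the line, transported to row
   vectors; [lebesgue_rV_box] computes it on boxes. *)
Fixpoint lebesgue_rV (R : realType) (n : nat) :
    {sigma_finite_measure set 'rV[R]_n -> \bar R} :=
  if n is m.+1 then lebesgue_rV_succ (lebesgue_rV R m)
  else @dirac _ 'rV[R]_0 0 R.

Lemma lebesgue_rV_box (R : realType) (n : nat) (A : 'I_n -> set R) :
  (forall i, measurable (A i)) ->
  lebesgue_rV R n [set x | forall i, A i (x ord0 i)] =
  (\prod_(i < n) lebesgue_measure (A i))%E.
Proof.
elim: n A => [|n IHn] A mA.
  by rewrite big_ord0 /= diracE mem_set//= => -[].
rewrite big_ord_recl -IHn//.
set B := (X in _ = (_ * lebesgue_rV R n X)%E).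
have mB : measurable B.
  rewrite (_ : B = \bigcap_(i in [set: 'I_n])
      ((fun x : 'rV[R]_n => x ord0 i) @^-1` A (lift ord0 i))).
    apply: fin_bigcap_measurable => // i _.
    rewrite -[X in measurable X]setTI.
    exact: (measurable_coord i measurableT (mA _)).
  by apply/seteqP; split => x /= => [h i _|h i]; exact: h.
transitivity ((lebesgue_measure \x lebesgue_rV R n)%E (A ord0 `*` B)); last first.
  exact: (product_measure1E lebesgue_measure _ (mA ord0) mB).
congr (product_measure1 _ _ _); apply/seteqP; split=> [p /= h|p /= [h0 h] i].
  by split=> [|i]; [rewrite -rV_cons0; exact: h|rewrite -rV_consS; exact: h].
by have [j ->|->] := unliftP ord0 i; rewrite ?rV_cons0 ?rV_consS.
Qed.

Section function_spaces.
Context {R : realType} {d : nat}.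
Notation mu := (lebesgue_rV R d).
Implicit Types (B : set 'rV[R]_d) (f u S phi : 'rV[R]_d -> R).

(* The norm and the balls of the normed module ['rV[R]_d] are those of the
   maximum norm; the Euclidean norm induces the same topology. *)
Definition eucl_norm (x : 'rV[R]_d) : R :=
  Num.sqrt (\sum_(i < d) x ord0 i ^+ 2).

Definition eball (x0 : 'rV[R]_d) (r : R) : set 'rV[R]_d :=
  [set x | eucl_norm (x - x0) < r].

(* A function on [B] is represented by a total function whose values outside
   [B] are ignored: [f \_ B] is its extension by 0 (see [restrict0]). *)
Definition in_Lp (p : \bar R) B f : Prop := f \_ B \in Lfun mu p.

Definition Lp_norm (p : \bar R) B f : \bar R := 'N[mu]_p[EFin \o (f \_ B)]%E.

Lemma restrict0 B f x : ~ B x -> (f \_ B) x = 0.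
Proof. by move=> Bx; rewrite patchE memNset. Qed.

Definition partial (i : 'I_d) f : 'rV[R]_d -> R := 'D_(delta_mx ord0 i) f.

(* [foldr partial f s] is the iterated partial derivative of [f] along the
   multi-index listed by [s]. *)
Definition smooth f : Prop := forall s : seq 'I_d,
  continuous (foldr partial f s : 'rV[R]_d -> R) /\
  forall (i : 'I_d) (x : 'rV[R]_d),
    derivable (foldr partial f s) x (delta_mx ord0 i).

Definition test_function B phi : Prop :=
  [/\ smooth phi,
      compact (closure [set x | phi x != 0]) &
      closure [set x | phi x != 0] `<=` B].

Definition weak_gradient B f (G : 'I_d -> 'rV[R]_d -> R) : Prop :=
  (forall i, in_Lp 2%:E B (G i)) /\
  forall i phi, test_function B phi ->
    (\int[mu]_(x in B) (f x * partial i phi x)%:E =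
     - \int[mu]_(x in B) (G i x * phi x)%:E)%E.

Definition in_H1 B f : Prop :=
  in_Lp 2%:E B f /\ exists G, weak_gradient B f G.

(* In the inequality, [G] is the gradient of the positive part of
   [u - kappa]: it belongs to H^1(B) as [u] does, and its weak gradient is
   unique up to a negligible set, so the quantification over [G] only fixes
   the representative. *)
Definition DG_plus (C : R) B S u : Prop :=
  [/\ in_Lp 2%:E B S,
      in_H1 B u &
      forall (x0 : 'rV[R]_d) (rho : R), eball x0 rho `<=` B ->
      forall (kappa r : R), 0 < r < rho ->
      forall G, weak_gradient B (u \- cst kappa)^\+ G ->
      (\int[mu]_(x in eball x0 r) (\sum_(i < d) G i x ^+ 2)%:E <=
       (C / (rho - r) ^+ 2)%:E *
         \int[mu]_(x in eball x0 rho) ((u \- cst kappa)^\+ x ^+ 2)%:E +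
       C%:E *
         \int[mu]_(x in eball x0 rho) (`|S x| * (u \- cst kappa)^\+ x)%:E)%E].

End function_spaces.

(* Main.v *)
Require Import Defs.
From mathcomp Require Import all_boot all_order all_algebra.
From mathcomp Require Import all_classical all_reals all_analysis.
From mathcomp Require Import measurable_realfun ess_sup_inf.
From mathcomp Require Import finmap ring lra.

(** De Giorgi's argument.  Let the levels [kappa_k] increase from 0 to [A] and
    the radii decrease from 1 to 3/4, and let [Y_k] be the integral of
    [(u - kappa_k)_+ ^ 2] over the [k]-th ball ([excess]).  If [A] dominates the
    norm of [S] and [Y_0] is small compared with [A ^ 2], then [Y_k] decays
    geometrically, so [(u - A)_+] vanishes on the ball of radius 3/4.  The decay
    rests on three facts.

    - Energy: the inequality of the class bounds the gradient of
      [(u - kappa_(k+1))_+] on an intermediate ball by [Y_k], up to a factor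
      that grows geometrically in [k].

    - Gain: a nonnegative [w] with weak gradient [G] satisfies, for all small
      [t > 0], an inequality of Nash type,
      [int_{B_r} w^2 <= C t^2 int_{B_rho} |G|^2 + 2 t^-d (int_{B_rho} w)^2].
      It comes from [w^2 <= (w(. + y) - w)^2 + 2 w w(. + y)], averaged over the
      translations [y] in a cube of side [t] ([averaging_estimate]); the first
      term is controlled by the gradient ([nsq_translate_cube]).

    - Nonlinearity: where [u > kappa_(k+1)], the truncation at [kappa_k] exceeds
      the gap of the levels, so the integral of [(u - kappa_(k+1))_+] is at most
      [Y_k / (kappa_(k+1) - kappa_k)].  The last term above is thus quadratic
      in [Y_k].

    Together they give [excess_step]; choosing [t] geometrically in [k] gives
    [excess_decay].

    The inequality of the class speaks of the weak gradient of [(u - kappa)_+],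
    so one must first know that this gradient exists ([weak_partial_ppart]).
    For [beta] of class [C^{1,1}], the difference quotients of [beta(f)] differ
    from [beta'(f)] times those of [f] by [O(h)] in [L^1], and the difference
    quotients of [f] are bounded in [L^2] and converge weakly to the weak
    derivative ([weak_partial_chain]); the positive part is then a limit of such
    [beta].  The [L^2] bound on difference quotients ([translation_estimate]) is
    proved by duality: against a test function, a translation can be
    differentiated under the integral sign.  Both duality arguments use that
    test functions are dense in [L^2] of a ball ([bump_dense]), which Dynkin's
    theorem reduces to smooth cutoffs of half spaces.

    Throughout, functions on a ball are extended by zero, so that translations
    act on the whole space as isometries. *)

Set Implicit Arguments.
Unset Strict Implicit.
Unset Printing Implicit Defensive.

Import Order.TTheory GRing.Theory Num.Theory.
Import numFieldNormedType.Exports.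

Local Open Scope classical_set_scope.
Local Open Scope ring_scope.

(** * Square integrable functions *)

Section square_integrable.
Context d (T : measurableType d) (R : realType) (mu : {measure set T -> \bar R}).
Implicit Types (f g h phi : T -> R) (A E : set T).

Definition L1 f := mu.-integrable setT (EFin \o f).

Definition L2 f := measurable_fun setT f /\ L1 (fun x => f x ^+ 2).

Definition ip f g : R := \int[mu]_x (f x * g x).

Definition nsq f : R := ip f f.

Lemma nsqE f : nsq f = \int[mu]_x (f x ^+ 2).
Proof. by rewrite /nsq /ip; under eq_Rintegral do rewrite -expr2. Qed.

Lemma L1_le f g : measurable_fun setT f -> L1 g -> (forall x, `|f x| <= g x) ->
  L1 f.
Proof.
move=> mf ig fg; apply: le_integrable ig => //; first exact/measurable_EFinP.
by move=> x _ /=; rewrite lee_fin (le_trans (fg x))// ler_norm.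
Qed.

Lemma L1D f g : L1 f -> L1 g -> L1 (fun x => f x + g x).
Proof.
move=> If Ig; have := integrableD measurableT If Ig.
by apply: eq_integrable.
Qed.

Lemma L1Z k f : L1 f -> L1 (fun x => k * f x).
Proof.
move=> If; have := integrableZl measurableT k If.
by apply: eq_integrable.
Qed.

Lemma L1B f g : L1 f -> L1 g -> L1 (fun x => f x - g x).
Proof.
move=> If Ig; have := integrableB measurableT If Ig.
by apply: eq_integrable.
Qed.

Lemma L1_measurable f : L1 f -> measurable_fun setT f.
Proof. by move=> /measurable_int/measurable_EFinP. Qed.

Lemma L1_norm f : L1 f -> L1 (fun x => `|f x|).
Proof.
move=> /[dup] If /L1_measurable mf; have := integrable_abse If.
by apply: eq_integrable.
Qed.

Lemma L2_measurable f : L2 f -> measurable_fun setT f. Proof. by case. Qed.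

Lemma L2_L1M f g : L2 f -> L2 g -> L1 (fun x => f x * g x).
Proof.
move=> [mf If] [mg Ig]; apply: (L1_le _ (L1D If Ig)); first exact: measurable_funM.
move=> x; rewrite normrM -(real_normK (num_real (f x))) -(real_normK (num_real (g x))).
by have := sqr_ge0 (`|f x| - `|g x|); nra.
Qed.

Lemma L2_le f g : measurable_fun setT f -> L2 g ->
  (forall x, `|f x| <= `|g x|) -> L2 f.
Proof.
move=> mf [mg Ig] fg; split=> //; apply: L1_le Ig _ => //.
  exact: measurable_funX.
move=> x; rewrite ger0_norm ?sqr_ge0//.
by rewrite -(real_normK (num_real (f x))) -(real_normK (num_real (g x))) lerXn2r ?nnegrE.
Qed.

Lemma L2D f g : L2 f -> L2 g -> L2 (fun x => f x + g x).
Proof.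
move=> /[dup] Lf [mf If] /[dup] Lg [mg Ig]; split; first exact: measurable_funD.
have := L1D If (L1D (L1Z 2 (L2_L1M Lf Lg)) Ig).
by apply: eq_integrable => // x _ /=; congr EFin; ring.
Qed.

Lemma L2Z k f : L2 f -> L2 (fun x => k * f x).
Proof.
move=> [mf If]; split; first exact: measurable_funM.
have := L1Z (k ^+ 2) If.
by apply: eq_integrable => // x _ /=; congr EFin; ring.
Qed.

Lemma L2B f g : L2 f -> L2 g -> L2 (fun x => f x - g x).
Proof.
move=> Lf /(L2Z (-1)) Lg; have := L2D Lf Lg.
by congr L2; apply/funext => x; rewrite mulN1r.
Qed.

Lemma L2Mb f h k : L2 f -> measurable_fun setT h -> (forall x, `|h x| <= k) ->
  L2 (fun x => h x * f x).
Proof.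
move=> /[dup] Lf [mf _] mh hk; apply: L2_le (L2Z k Lf) _.
  exact: measurable_funM.
by move=> x; rewrite !normrM ler_wpM2r// (le_trans (hk x))// ler_norm.
Qed.

Lemma L2_indic A : measurable A -> (mu A < +oo)%E -> L2 \1_A.
Proof.
move=> mA A_fin; split; first exact: measurable_indic.
have mi : measurable_fun setT (\1_A : T -> R) by exact: measurable_indic.
apply/integrableP; split.
  by apply/measurable_EFinP; exact: measurable_funX.
rewrite (eq_integral (fun x => (\1_A x)%:E)) ?integral_indic ?setIT// => x _ /=.
by rewrite indicE; case: (_ \in _); rewrite ?expr1n ?expr0n ?normr1 ?normr0.
Qed.

Lemma L2_restrict A f : measurable A -> L2 f -> L2 (fun x => \1_A x * f x).
Proof.
move=> mA Lf.
have mi : measurable_fun setT (\1_A : T -> R) by exact: measurable_indic.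
apply: (@L2Mb _ _ 1) => //.
by move=> x; rewrite indicE; case: (_ \in _); rewrite ?normr1 ?normr0.
Qed.

Lemma ipC f g : ip f g = ip g f.
Proof. by apply: eq_Rintegral => x _; rewrite mulrC. Qed.

Lemma ipDl f g h : L2 f -> L2 g -> L2 h ->
  ip (fun x => f x + g x) h = ip f h + ip g h.
Proof.
move=> Lf Lg Lh; rewrite /ip -RintegralD//; [|exact: L2_L1M..].
by apply: eq_Rintegral => x _; rewrite mulrDl.
Qed.

Lemma ipZl k f h : L2 f -> L2 h -> ip (fun x => k * f x) h = k * ip f h.
Proof.
move=> Lf Lh; rewrite /ip -RintegralZl//; last exact: L2_L1M.
by apply: eq_Rintegral => x _; rewrite mulrA.
Qed.

Lemma ipBl f g h : L2 f -> L2 g -> L2 h ->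
  ip (fun x => f x - g x) h = ip f h - ip g h.
Proof.
move=> Lf Lg Lh; rewrite /ip -RintegralB//; [|exact: L2_L1M..].
by apply: eq_Rintegral => x _; rewrite mulrBl.
Qed.

Lemma ipDr f g h : L2 f -> L2 g -> L2 h ->
  ip h (fun x => f x + g x) = ip h f + ip h g.
Proof. by move=> ? ? ?; rewrite ipC ipDl// !(ipC h). Qed.

Lemma ipBr f g h : L2 f -> L2 g -> L2 h ->
  ip h (fun x => f x - g x) = ip h f - ip h g.
Proof. by move=> ? ? ?; rewrite ipC ipBl// !(ipC h). Qed.

Lemma ipZr k f h : L2 f -> L2 h -> ip h (fun x => k * f x) = k * ip h f.
Proof. by move=> ? ?; rewrite ipC ipZl// ipC. Qed.

Lemma nsq_ge0 f : 0 <= nsq f.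
Proof. by rewrite nsqE Rintegral_ge0// => x _; exact: sqr_ge0. Qed.

Lemma le_ip f g f' g' : L1 (fun x => f x * g x) -> L1 (fun x => f' x * g' x) ->
  (forall x, f x * g x <= f' x * g' x) -> ip f g <= ip f' g'.
Proof. by move=> Lf Lg fg; apply: le_Rintegral. Qed.

Lemma le_nsq f g : L2 f -> L2 g -> (forall x, `|f x| <= `|g x|) ->
  nsq f <= nsq g.
Proof.
move=> Lf Lg fg; apply: le_ip; [exact: L2_L1M..|] => x.
rewrite -!expr2 -(real_normK (num_real (f x))) -(real_normK (num_real (g x))).
by rewrite lerXn2r ?nnegrE.
Qed.

Lemma nsqZ k f : L2 f -> nsq (fun x => k * f x) = k ^+ 2 * nsq f.
Proof. by move=> Lf; rewrite /nsq ipZl// ?ipZr//; [ring|exact: L2Z]. Qed.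

Lemma nsqD_le f g : L2 f -> L2 g ->
  nsq (fun x => f x + g x) <= 2 * nsq f + 2 * nsq g.
Proof.
move=> Lf Lg; have := nsq_ge0 (fun x => f x - g x).
rewrite /nsq ipBl ?ipBr ?ipDl ?ipDr//; do ?[exact: L2B|exact: L2D].
by rewrite (ipC g f); lra.
Qed.

(** Young's form of the Cauchy-Schwarz inequality: it avoids square roots, and
    the free parameter [k] lets a small first factor compensate a merely
    bounded second one. *)
Lemma ip_young k f g : 0 < k -> L2 f -> L2 g ->
  2 * `|ip f g| <= k * nsq f + k^-1 * nsq g.
Proof.
move=> k0 Lf Lg; have k1 : k * k^-1 = 1 by rewrite divff ?gt_eqF.
suff H s : s ^+ 2 = 1 -> 2 * s * ip f g <= k * nsq f + k^-1 * nsq g.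
  have /(H 1) h1 : (1 : R) ^+ 2 = 1 by ring.
  have /(H (-1)) h2 : (-1 : R) ^+ 2 = 1 by ring.
  by have [_|_] := ler0P (ip f g); lra.
move=> s1; have := nsq_ge0 (fun x => k * f x - s * g x).
rewrite /nsq ipBl ?ipBr ?ipZl ?ipZr//; do ?[exact: L2Z|apply: L2B; exact: L2Z].
rewrite (ipC g f) => h.
have ki : 0 < k^-1 by rewrite invr_gt0.
have : k^-1 * (k * (k * ip f f) - s * (k * ip f g) -
  (k * (s * ip f g) - s * (s * ip g g))) >= 0 by nra.
rewrite (_ : k^-1 * _ = (k * k^-1) * (k * ip f f) - 2 * (k * k^-1) * s * ip f g
  + s ^+ 2 * k^-1 * ip g g); last by ring.
rewrite k1 s1; lra.
Qed.

(** Dominated convergence in [L^2]: the squared differences are dominated by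
    [4 g ^ 2]. *)
Lemma nsq_dominated (f_ : nat -> T -> R) f g : (forall n, measurable_fun setT (f_ n)) ->
  measurable_fun setT f -> L2 g -> (forall n x, `|f_ n x| <= `|g x|) ->
  (forall x, f_ n x @[n --> \oo] --> f x) ->
  L2 f /\ nsq (fun x => f_ n x - f x) @[n --> \oo] --> 0.
Proof.
move=> mf_ mf Lg f_g f_f.
have fg x : `|f x| <= `|g x|.
  apply: (ler_cvg_to (cvg_norm (f_f x)) (cvg_cst _)).
  by apply: nearW => n; exact: f_g.
have Lf : L2 f by exact: L2_le Lg _.
split=> //.
pose G x := 4 * g x ^+ 2.
have IG : L1 G by apply: L1Z; case: Lg.
have m_ n : measurable_fun setT (fun x => (f_ n x - f x) ^+ 2).
  by apply: measurable_funX; exact: measurable_funB.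
have h : (\int[mu]_x ((f_ n x - f x) ^+ 2)%:E)%E @[n --> \oo] --> 0%E.
  rewrite -(integral0 mu setT).
  apply: (@dominated_cvg _ T R mu setT measurableT
    (fun n x => ((f_ n x - f x) ^+ 2)%:E) (cst 0%E) (EFin \o G)) => //.
  - by move=> n; exact/measurable_EFinP.
  - move=> x _; apply/fine_cvgP; split; first exact: nearW.
    rewrite /comp/= [X in _ --> X](_ : _ = (f x - f x) * (f x - f x)); last first.
      by rewrite /= subrr mul0r.
    under eq_fun do rewrite /= expr2.
    by apply: cvgM; apply: cvgB => //; exact: cvg_cst.
  - move=> n x _ /=; rewrite lee_fin ger0_norm ?sqr_ge0// /G.
    have h : `|f_ n x - f x| <= 2 * `|g x|.
      by rewrite (le_trans (ler_normB _ _))//; have := f_g n x; have := fg x; lra.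
    rewrite -(real_normK (num_real (_ - _))) -(real_normK (num_real (g x))).
    have := normr_ge0 (f_ n x - f x); have := normr_ge0 (g x); nra.
under eq_fun do rewrite nsqE.
exact: (fine_cvg h).
Qed.

End square_integrable.

(** * Density in L2 by Dynkin's theorem *)

Section density.
Context d (T : measurableType d) (R : realType) (mu : {measure set T -> \bar R}).
Implicit Types (f g h phi : T -> R) (A E : set T).
Variable V : set (T -> R).
Hypothesis VL2 : forall phi, V phi -> L2 mu phi.
Hypothesis V0 : V (fun=> 0).
Hypothesis VD : forall phi psi, V phi -> V psi -> V (fun x => phi x + psi x).
Hypothesis VZ : forall k phi, V phi -> V (fun x => k * phi x).

Definition approximable f := L2 mu f /\
  forall e, 0 < e -> exists2 phi, V phi & nsq mu (fun x => f x - phi x) <= e.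

(** Approximability passes to [L^2] limits, by [nsqD_le] instead of the triangle
    inequality. *)
Lemma approximable_lim f : L2 mu f ->
  (forall e, 0 < e -> exists2 g, approximable g & nsq mu (fun x => f x - g x) <= e) ->
  approximable f.
Proof.
move=> Lf H; split=> // e e0.
have e4 : 0 < e / 4 by rewrite divr_gt0.
have [g [Lg /(_ _ e4)[phi Vphi gphi]] fg] := H _ e4.
exists phi => //; have Lphi := VL2 Vphi.
rewrite (_ : (fun x => _) = (fun x => (f x - g x) + (g x - phi x))); last first.
  by apply/funext => x; ring.
by rewrite (le_trans (nsqD_le _ _))//; [exact: L2B|exact: L2B|lra].
Qed.

Lemma approximable_cvg (f_ : nat -> T -> R) f g : (forall n, approximable (f_ n)) ->
  measurable_fun setT f -> L2 mu g -> (forall n x, `|f_ n x| <= `|g x|) ->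
  (forall x, f_ n x @[n --> \oo] --> f x) -> approximable f.
Proof.
move=> af mf Lg fg ff.
have mf_ n : measurable_fun setT (f_ n) by case: (af n) => -[].
have [Lf /cvgr0_norm_le c0] := nsq_dominated mf_ mf Lg fg ff.
apply: approximable_lim => // e e0.
have [N _ /(_ N (leqnn N)) h] := c0 _ e0; exists (f_ N) => //.
apply: le_trans h; rewrite ger0_norm ?nsq_ge0//.
have Ln := (af N).1.
apply: le_nsq; [exact: L2B|exact: L2B|by move=> x; rewrite distrC].
Qed.

Lemma approximableV phi : V phi -> approximable phi.
Proof.
move=> Vphi; split; first exact: VL2.
move=> e e0; exists phi => //; rewrite nsqE.
by under eq_Rintegral do rewrite subrr expr0n/=; rewrite /Rintegral integral0/= ltW.
Qed.

Lemma approximableD f g : approximable f -> approximable g ->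
  approximable (fun x => f x + g x).
Proof.
move=> [Lf af] [Lg ag]; split; first exact: L2D.
move=> e e0; have e4 : 0 < e / 4 by rewrite divr_gt0.
have [phi Vphi fphi] := af _ e4; have [psi Vpsi gpsi] := ag _ e4.
exists (fun x => phi x + psi x); first exact: VD.
have Lphi := VL2 Vphi; have Lpsi := VL2 Vpsi.
rewrite (_ : (fun x => _) = (fun x => (f x - phi x) + (g x - psi x))); last first.
  by apply/funext => x; ring.
by rewrite (le_trans (nsqD_le _ _))//; [exact: L2B|exact: L2B|lra].
Qed.

Lemma approximableZ k f : approximable f -> approximable (fun x => k * f x).
Proof.
move=> [Lf af]; split; first exact: L2Z.
move=> e e0; have k1 : 0 < k ^+ 2 + 1 by have := sqr_ge0 k; lra.
have ek : 0 < e / (k ^+ 2 + 1) by rewrite divr_gt0.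
have [phi Vphi fphi] := af _ ek.
exists (fun x => k * phi x); first exact: VZ.
have Lphi := VL2 Vphi.
rewrite (_ : (fun x => _) = (fun x => k * (f x - phi x))); last first.
  by apply/funext => x; ring.
rewrite nsqZ; last exact: L2B.
rewrite ler_pdivlMr// in fphi; apply: le_trans fphi.
by have := nsq_ge0 mu (fun x => f x - phi x); nra.
Qed.

Lemma approximable_sum n (f : nat -> T -> R) :
  (forall i, approximable (f i)) -> approximable (fun x => \sum_(i < n) f i x).
Proof.
move=> af; elim: n => [|n IH].
  by under eq_fun do rewrite big_ord0; exact: approximableV.
by under eq_fun do rewrite big_ord_recr; exact: approximableD.
Qed.

Lemma cvg_indic_bigcup (F : (set T)^nat) x : trivIset setT F ->
  \sum_(i < n) \1_(F i) x @[n --> \oo] --> (\1_(\bigcup_i F i) x : R).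
Proof.
move=> tF; have [[N _ FN]|nF] := pselect ((\bigcup_i F i) x); last first.
  rewrite indicE memNset//; under eq_fun.
    move=> n; rewrite big1; last first.
      by move=> i _; rewrite indicE memNset// => Fx; apply: nF; exists i.
    over.
  exact: cvg_cst.
rewrite indicE mem_set//; last by exists N.
apply: (@cvg_near_cst _ (R^o : normedModType R)).
exists N.+1 => // n /= Nn.
rewrite (bigD1 (Ordinal Nn))//= indicE mem_set// big1 ?addr0// => i iN.
rewrite indicE memNset// => Fi.
move/trivIsetP : tF => /(_ i N Logic.I Logic.I iN)/seteqP[/(_ x)] h _.
by apply: h.
Qed.

Variables (P : set (set T)) (E : set T).
Hypothesis mE : measurable E.
Hypothesis E_fin : (mu E < +oo)%E.
Hypothesis PI : setI_closed P.
Hypothesis Pmeas : forall A, measurable A -> <<s P >> A.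
Hypothesis Pm : P `<=` measurable.
Hypothesis PT : P setT.
Hypothesis Papprox : forall A, P A -> approximable (fun x => \1_E x * \1_A x).

(** The measurable sets [A] for which the indicator of [E] cut by [A] is
    approximable form a Dynkin system: complements are taken inside [E], and
    countable disjoint unions are dominated limits of finite ones.  So it
    suffices to treat a generating pi-system. *)
Lemma approximable_indic A : measurable A ->
  approximable (fun x => \1_E x * \1_A x).
Proof.
pose G := [set A | measurable A /\ approximable (fun x => \1_E x * \1_A x)].
suff H : <<d P >> `<=` G.
  move=> mA; suff [] : G A by [].
  by apply: H; rewrite setI_closed_g_dynkin_g_sigma_algebra//; exact: Pmeas.
apply: smallest_sub; last by move=> B PB; split; [exact: Pm|exact: Papprox].
split.
- by split => //; exact: Papprox.
- move=> B [mB aB]; split; first exact: measurableC.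
  have := approximableD (Papprox PT) (approximableZ (-1) aB).
  congr approximable; apply/funext => x.
  by rewrite indicC indicT !indicE; case: (x \in E); case: (x \in B) => /=; ring.
- move=> F tF GF.
  have mF : measurable (\bigcup_k F k) by apply: bigcup_measurable => k _; case: (GF k).
  split=> //.
  have a1 n : approximable (fun x => \sum_(i < n) (\1_E x * \1_(F i) x)).
    by apply: (@approximable_sum n (fun i x => \1_E x * \1_(F i) x)) => i; case: (GF i).
  apply: (@approximable_cvg _ _ (\1_E) a1).
  + by apply: measurable_funM; exact: measurable_indic.
  + exact: L2_indic.
  + move=> n x; rewrite -mulr_sumr normrM ler_piMr//.
    rewrite ger0_norm; last by apply: sumr_ge0.
    have : nondecreasing_seq (fun m => \sum_(i < m) (\1_(F i) x : R)).
      apply/nondecreasing_seqP => m; rewrite big_ord_recr/= lerDl//.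
    move=> /nondecreasing_cvgn_le h; have cv := cvg_indic_bigcup (x := x) tF.
    have := h _ n; move=> /(_ (cvgP _ cv)); rewrite (cvg_lim _ cv)// => /le_trans; apply.
    by rewrite indicE; case: (_ \in _).
  + move=> x; under eq_fun do rewrite -mulr_sumr.
    by apply: cvgM; [exact: cvg_cst|exact: cvg_indic_bigcup].
Qed.

Import HBNNSimple.

Lemma approximable_ge0 f : L2 mu f -> (forall x, 0 <= f x) ->
  approximable (fun x => \1_E x * f x).
Proof.
move=> Lf f0; have mf := L2_measurable Lf.
have mf' : measurable_fun setT (EFin \o f) by exact/measurable_EFinP.
pose s n := nnsfun_approx measurableT mf' n.
have a1 n : approximable (fun x => \1_E x * s n x).
  have [N [c [F [mF sE]]]] : exists N (c : nat -> R) (F : nat -> set T),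
      (forall i, measurable (F i)) /\
      forall x, s n x = \sum_(i < N) (c i * \1_(F i) x).
    exists (#|` fset_set (s n @` setT)|)%fset, (nth 0 (fset_set (s n @` setT))).
    exists (fun i => s n @^-1` [set (fset_set (s n @` setT))`_i]); split.
      by move=> i; apply: measurable_funPTI; exact: measurable_set1.
    by move=> x; exact: fimfunEord.
  under eq_fun do rewrite sE mulr_sumr.
  apply: (@approximable_sum N (fun i x => \1_E x * (c i * \1_(F i) x))) => i.
  under eq_fun do rewrite mulrCA.
  by apply: approximableZ; exact: approximable_indic.
apply: (@approximable_cvg _ _ f a1) => //.
- by apply: measurable_funM => //; exact: measurable_indic.
- move=> n x; rewrite normrM (ger0_norm (f0 x)).
  have s0 : 0 <= s n x by [].
  have sf : s n x <= f x.
    rewrite -lee_fin /s nnsfun_approxE.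
    by apply: (le_approx (f := EFin \o f)) => // y _; rewrite lee_fin.
  rewrite (ger0_norm s0) indicE.
  by case: (_ \in _); rewrite ?normr1 ?normr0 ?mul1r ?mul0r.
- move=> x; apply: cvgM; first exact: cvg_cst.
  apply: (fine_cvg (cvg_nnsfun_approx measurableT mf' _ Logic.I)).
  by move=> y _; rewrite lee_fin.
Qed.

(** Nonnegative functions are dominated limits of simple ones, which reduces
    density to indicator functions. *)
Theorem L2_dense f : L2 mu f -> approximable (fun x => \1_E x * f x).
Proof.
move=> Lf; have mf := L2_measurable Lf.
have Lp : L2 mu (fun x => Num.max (f x) 0).
  apply: L2_le Lf _; first exact: measurable_maxr.
  by move=> x; case: (lerP (f x) 0) => //; rewrite normr0.
have Ln : L2 mu (fun x => Num.max (- f x) 0).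
  apply: L2_le Lf _; first by apply: measurable_maxr => //; exact: measurableT_comp.
  by move=> x; case: (lerP (- f x) 0); rewrite ?normr0 ?normrN.
have := approximableD (approximable_ge0 Lp _) (approximableZ (-1) (approximable_ge0 Ln _)).
rewrite (_ : (fun x => _ + _) = (fun x => \1_E x * f x)); last first.
  apply/funext => x.
  case: (lerP (f x) 0); case: (lerP (- f x) 0) => h1 h2; [|ring..|].
    have -> : f x = 0 by lra.
    by ring.
  by exfalso; lra.
by apply; move=> x; rewrite le_max lexx orbT.
Qed.

End density.

(** * The Euclidean norm and Borel functions *)

Section euclidean_norm.
Context {R : realType} {d : nat}.
Implicit Types x y : 'rV[R]_d.

Lemma eucl_norm_ge0 x : 0 <= eucl_norm x. Proof. exact: sqrtr_ge0. Qed.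

Lemma sqr_eucl_norm x : eucl_norm x ^+ 2 = \sum_(i < d) x ord0 i ^+ 2.
Proof. by rewrite sqr_sqrtr// sumr_ge0// => i _; exact: sqr_ge0. Qed.

Lemma eucl_norm0 : eucl_norm (0 : 'rV[R]_d) = 0.
Proof. by rewrite /eucl_norm big1 ?sqrtr0// => i _; rewrite mxE expr0n. Qed.

(** Expanding the nonnegative sum of the squares of [b x_i - a y_i], where [a]
    and [b] are the norms of [x] and [y]. *)
Lemma dot_le_eucl_norm x y :
  \sum_(i < d) x ord0 i * y ord0 i <= eucl_norm x * eucl_norm y.
Proof.
have key (a b : R) : 0 <= a -> 0 <= b -> a = eucl_norm x -> b = eucl_norm y ->
    0 < a * b -> \sum_(i < d) x ord0 i * y ord0 i <= a * b.
  move=> a0 b0 ax bx ab.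
  have : 0 <= \sum_(i < d) (b * x ord0 i - a * y ord0 i) ^+ 2.
    by apply: sumr_ge0 => i _; exact: sqr_ge0.
  under eq_bigr do rewrite sqrrB !exprMn.
  rewrite big_split/= sumrB/= -!mulr_sumr -!sqr_eucl_norm -ax -bx.
  rewrite (eq_bigr (fun i => (2 * a * b) * (x ord0 i * y ord0 i))); last first.
    by move=> i _; rewrite -mulr_natl; ring.
  rewrite -mulr_sumr; set S := \sum_(i < d) _ => h.
  have : a * b * S <= a * b * (a * b) by nra.
  by rewrite ler_pM2l.
have zero (z : 'rV[R]_d) : eucl_norm z = 0 -> forall i, z ord0 i = 0 :> R.
  move=> z0 i; have := sqr_eucl_norm z; rewrite z0 expr0n/= => /esym/eqP.
  rewrite psumr_eq0; last by move=> j _; exact: sqr_ge0.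
  by move=> /allP/(_ i); rewrite mem_index_enum sqrf_eq0 => /(_ isT)/eqP.
have := eucl_norm_ge0 x; rewrite le_eqVlt => /orP[/eqP/esym x0|x0].
  by rewrite x0 mul0r big1// => i _; rewrite (zero x)// mul0r.
have := eucl_norm_ge0 y; rewrite le_eqVlt => /orP[/eqP/esym y0|y0].
  by rewrite y0 mulr0 big1// => i _; rewrite (zero y)// mulr0.
by apply: key => //; [exact: ltW|exact: ltW|exact: mulr_gt0].
Qed.

Lemma ler_eucl_normD x y : eucl_norm (x + y) <= eucl_norm x + eucl_norm y.
Proof.
have xy0 : 0 <= eucl_norm x + eucl_norm y by rewrite addr_ge0// eucl_norm_ge0.
rewrite -(@ler_pXn2r _ 2)// ?nnegrE ?eucl_norm_ge0//.
rewrite sqrrD !sqr_eucl_norm.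
under eq_bigr do rewrite mxE sqrrD.
rewrite !big_split/= lerD2r lerD2l.
by have := dot_le_eucl_norm x y; lra.
Qed.

Lemma eucl_norm_coord x i : `|x ord0 i| <= eucl_norm x.
Proof.
rewrite -sqrtr_sqr ler_sqrt; last by apply: sumr_ge0 => j _; exact: sqr_ge0.
by rewrite (bigD1 i)//= lerDl sumr_ge0// => j _; exact: sqr_ge0.
Qed.

Lemma eucl_norm_le_sum x : eucl_norm x <= \sum_(i < d) `|x ord0 i|.
Proof.
have s0 : 0 <= \sum_(i < d) `|x ord0 i| by exact: sumr_ge0.
rewrite -(@ler_pXn2r _ 2)// ?nnegrE ?eucl_norm_ge0// sqr_eucl_norm.
rewrite [leRHS]expr2 mulr_suml; apply: ler_sum => i _.
rewrite -real_normK ?num_real// expr2 ler_wpM2l//.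
by rewrite (bigD1 i)//= lerDl sumr_ge0.
Qed.

Lemma sub_eball (x y : 'rV[R]_d) (r rho : R) : eucl_norm (x - y) + r <= rho ->
  eball x r `<=` eball y rho.
Proof.
move=> xy z; rewrite /eball/= => zx; apply: lt_le_trans xy.
rewrite (_ : z - y = (x - y) + (z - x)); last by rewrite [RHS]addrC subrKA.
by rewrite (le_lt_trans (ler_eucl_normD _ _))// ltrD2l.
Qed.

End euclidean_norm.

Section borel_rV.
Context {R : realType} {d : nat}.
Implicit Types (x y h : 'rV[R]_d) (f : 'rV[R]_d -> R).

(** Rounding each coordinate down to the grid of mesh [1 / (n + 1)] writes a
    continuous function as a limit of functions of a countable-valued
    measurable map. *)
Lemma continuous_measurable_rV f : continuous f -> measurable_fun setT f.
Proof.
move=> cf.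
pose g n x : 'rV[int]_d := \row_j Num.floor (n.+1%:R * x ord0 j).
pose g' n x : 'rV[R]_d := \row_j ((g n x ord0 j)%:~R / n.+1%:R).
have mg n z : measurable (g n @^-1` [set z]).
  rewrite (_ : _ @^-1` _ = \bigcap_(j in [set: 'I_d])
     ((fun x : 'rV[R]_d => x ord0 j) @^-1` [set t | Num.floor (n.+1%:R * t) = z ord0 j])).
    apply: fin_bigcap_measurable => // j _.
    rewrite -[X in measurable X]setTI; apply: (measurable_coord j measurableT).
    have n0 : (0 : R) < n.+1%:R by [].
    rewrite (_ : [set t | _] = `[(z ord0 j)%:~R / n.+1%:R, (z ord0 j + 1)%:~R / n.+1%:R[%classic).
      exact: measurable_itv.
    apply/seteqP; split => t /=; rewrite in_itv/= ler_pdivrMr// ltr_pdivlMr// ![t * _]mulrC.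
      by move=> <-; rewrite floor_le_tmp// floorD1_gt.
    by move=> H; exact: floor_def.
  apply/seteqP; split => x /=.
    by move=> <- j _ /=; rewrite mxE.
  by move=> H; apply/rowP => j; rewrite mxE H.
apply: (@measurable_fun_cvg _ _ _ _ (fun n => f \o g' n)) => // [n|x _].
  move=> _ Y mY; rewrite setTI.
  rewrite (_ : _ @^-1` _ = \bigcup_(z in [set z : 'rV[int]_d |
      Y (f (\row_j ((z ord0 j)%:~R / n.+1%:R)))]) (g n @^-1` [set z])).
    rewrite bigcup_mkcond; apply: countable_bigcupT_measurable => [|z].
      exact: countableP.
    by case: ifP.
  apply/seteqP; split => x /=.
    by move=> Yx; exists (g n x).
  by move=> [z Yz /= gz]; rewrite /= /g' gz.
apply: (cvg_comp (g' ^~ x)) (cf x).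
apply/cvg_ballP => e e0; near=> n.
split=> // i j; rewrite /ball /= !mxE ord1.
have n0 : (0 : R) < n.+1%:R by [].
have ne : (n.+1%:R)^-1 < e by near: n; exact: near_infty_natSinv_lt (PosNum e0).
apply: le_lt_trans ne.
have := floor_itv (n.+1%:R * x ord0 j); rewrite intrD.
set t := x ord0 j; set F := (_)%:~R; move=> /andP[h1 h2].
rewrite (_ : t - F / n.+1%:R = (n.+1%:R * t - F) / n.+1%:R); last first.
  by rewrite mulrBl mulrAC divff ?mul1r// gt_eqF.
rewrite normrM (gtr0_norm (x := n.+1%:R^-1)) ?invr_gt0// ler_piMl ?invr_ge0//.
rewrite ger0_norm; lra.
Unshelve. all: by end_near. Qed.

End borel_rV.

(** * Translation invariance; balls and half spaces *)

Section translation_invariance.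
Context {R : realType}.

Let shift_preimage_itv (c a b : R) :
  (fun t : R => t + c) @^-1` `]a, b] = `]a - c, b - c]%classic.
Proof.
by apply/seteqP; split => t /=; rewrite !in_itv/= ltrBlDr lerBrDr.
Qed.

Lemma measurable_shiftR (c : R) :
  measurable_fun setT ((fun t => t + c) : measurableTypeR R -> measurableTypeR R).
Proof. by apply: measurable_funD. Qed.

Lemma lebesgue_measure_shift (c : R) (A : set R) : measurable A ->
  lebesgue_measure ((fun t : R => t + c) @^-1` A) = lebesgue_measure A.
Proof.
move=> mA; rewrite -[LHS]/(pushforward lebesgue_measure
  ((fun t => t + c) : measurableTypeR R -> measurableTypeR R) A).
apply/esym/lebesgue_measure_unique => //=; first exact: measurable_shiftR.
move=> _ _ [[a b]] _ <-; rewrite /pushforward shift_preimage_itv !lebesgue_measure_itv/=.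
rewrite !lte_fin ltrD2r; case: ifP => // _; rewrite -!EFinD; congr EFin; lra.
Qed.

Lemma ge0_integral_shiftR (c : R) (f : R -> \bar R) :
  measurable_fun setT (f : measurableTypeR R -> \bar R) -> (forall x, 0 <= f x)%E ->
  (\int[lebesgue_measure]_x f (x + c)%R = \int[lebesgue_measure]_x f x)%E.
Proof.
move=> mf f0.
have ms := measurable_shiftR c.
transitivity (\int[pushforward lebesgue_measure
  ((fun t => t + c)%R : measurableTypeR R -> measurableTypeR R)]_x f x)%E.
  by rewrite ge0_integral_pushforward.
apply: eq_measure_integral => A mA _; exact: lebesgue_measure_shift.
Qed.

Lemma measurable_shift n (h : 'rV[R]_n) :
  measurable_fun setT (fun x : 'rV[R]_n => x + h).
Proof.
apply: measurable_fun_coordP => i.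
under eq_fun do rewrite mxE.
by apply: measurable_funD => //; exact: measurable_coord.
Qed.

(** By induction on the dimension: the sections of a translated set are
    translates of sections, and the integral over the first coordinate is
    translation invariant. *)
Lemma lebesgue_rV_shift n (h : 'rV[R]_n) (A : set 'rV[R]_n) : measurable A ->
  lebesgue_rV R n ((fun x => x + h) @^-1` A) = lebesgue_rV R n A.
Proof.
elim: n h A => [|n IH] h A mA.
  rewrite (_ : (fun x => x + h) = id)//.
  by apply/funext => x; apply/rowP => -[].
pose C := @rV_cons R n @^-1` A.
have mC : measurable C.
  by rewrite -[X in measurable X]setTI; exact: measurable_rV_cons.
pose h' : 'rV[R]_n := \row_j h ord0 (lift ord0 j).
rewrite /= /lebesgue_rV_succ /pushforward.
rewrite (_ : _ @^-1` _ = [set p | C (p.1 + h ord0 ord0, p.2 + h')]); last first.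
  rewrite /C; apply/funext => -[a y] /=; congr A; apply/rowP => j.
  rewrite [LHS]mxE; have [k ->|->] := unliftP ord0 j.
    by rewrite !rV_consS /= !mxE.
  by rewrite !rV_cons0.
rewrite /product_measure1.
transitivity (\int[lebesgue_measure]_x
  (lebesgue_rV R n (xsection C (x + h ord0 ord0)%R)))%E.
  apply: eq_integral => x _ /=.
  rewrite -[RHS](IH h'); last exact: measurable_xsection.
  by congr (lebesgue_rV R n _); apply/seteqP; split => y /=; rewrite /xsection/= !inE.
rewrite (ge0_integral_shiftR _ (f := fun x => lebesgue_rV R n (xsection C x)))//.
exact: measurable_fun_xsection.
Qed.

Section integral_shift.
Context {n : nat}.
Notation mu := (lebesgue_rV R n).

Lemma ge0_integral_shift (h : 'rV[R]_n) (f : 'rV[R]_n -> \bar R) :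
  measurable_fun setT f -> (forall x, 0 <= f x)%E ->
  (\int[mu]_x f (x + h)%R = \int[mu]_x f x)%E.
Proof.
move=> mf f0; have ms := measurable_shift h.
transitivity (\int[pushforward mu (fun x => x + h)%R]_x f x)%E.
  by rewrite ge0_integral_pushforward.
by apply: eq_measure_integral => A mA _; exact: lebesgue_rV_shift.
Qed.

Lemma L1_shift (h : 'rV[R]_n) f : L1 mu f -> L1 mu (fun x => f (x + h)).
Proof.
move=> /integrableP[mf fi]; apply/integrableP.
have mf' : measurable_fun setT ((EFin \o f) \o (fun x => x + h)).
  by apply: measurableT_comp => //; exact: measurable_shift.
split; first exact: mf'.
rewrite (_ : (\int[mu]_x _)%E = (\int[mu]_x `|(EFin \o f) x|)%E)//.
rewrite -(ge0_integral_shift h (f := fun x => `|(EFin \o f) x|%E))//.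
exact: measurableT_comp.
Qed.

Lemma Rintegral_shift (h : 'rV[R]_n) f : L1 mu f ->
  \int[mu]_x f (x + h) = \int[mu]_x f x.
Proof.
move=> /[dup] /(L1_shift h) fh If; congr fine; have ms := measurable_shift h.
transitivity (\int[pushforward mu (fun x => x + h)%R]_x (f x)%:E)%E.
  rewrite integral_pushforward//.
  by apply/measurable_EFinP; exact: L1_measurable If.
by apply: eq_measure_integral => A mA _; exact: lebesgue_rV_shift.
Qed.

Lemma L2_shift (h : 'rV[R]_n) f : L2 mu f -> L2 mu (fun x => f (x + h)).
Proof.
move=> [mf If]; split; last exact: L1_shift If.
by apply: measurableT_comp => //; exact: measurable_shift.
Qed.

Lemma ip_shift (h : 'rV[R]_n) f g : L2 mu f -> L2 mu g ->
  ip mu (fun x => f (x + h)) (fun x => g (x + h)) = ip mu f g.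
Proof. by move=> Lf Lg; apply: (Rintegral_shift h (f := fun x => f x * g x)); exact: L2_L1M. Qed.

End integral_shift.

End translation_invariance.

Section balls_and_half_spaces.
Context {R : realType} {d : nat}.
Notation mu := (lebesgue_rV R d).

Lemma measurable_box (A : 'I_d -> set R) : (forall i, measurable (A i)) ->
  measurable [set x : 'rV[R]_d | forall i, A i (x ord0 i)].
Proof.
move=> mA; rewrite (_ : [set x | _] = \bigcap_(i in [set: 'I_d])
    ((fun x : 'rV[R]_d => x ord0 i) @^-1` A i)).
  apply: fin_bigcap_measurable => // i _.
  rewrite -[X in measurable X]setTI.
  exact: (measurable_coord i measurableT (mA i)).
by apply/seteqP; split => x /= => [h i _|h i]; exact: h.
Qed.

Lemma measurable_eucl_norm (y : 'rV[R]_d) :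
  measurable_fun setT (fun x : 'rV[R]_d => eucl_norm (x - y)).
Proof.
have ms : measurable_fun setT (@Num.sqrt R).
  by apply: continuous_measurable_fun; exact: sqrt_continuous.
apply: (measurableT_comp ms).
apply: measurable_sum => i; under eq_fun do rewrite !mxE.
by apply: measurable_funX; apply: measurable_funB => //; exact: measurable_coord.
Qed.

Lemma measurable_eball (y : 'rV[R]_d) (r : R) : measurable (eball y r).
Proof.
rewrite -[eball y r]setTI (_ : eball y r = (fun x => eucl_norm (x - y)) @^-1` `]-oo, r[).
  exact: (measurable_eucl_norm y).
by apply/seteqP; split => x /=; rewrite in_itv.
Qed.

Lemma eball_finite (y : 'rV[R]_d) (r : R) : (mu (eball y r) < +oo)%E.
Proof.
pose Q := [set x : 'rV[R]_d | forall i, `[y ord0 i - r, y ord0 i + r]%classic (x ord0 i)].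
have mQ : measurable Q.
  by apply: (@measurable_box (fun i => `[y ord0 i - r, y ord0 i + r]%classic)).
apply: (@le_lt_trans _ _ (mu Q)).
  have me := measurable_eball y r.
  apply: le_measure; [exact: mem_set|exact: mem_set|].
  move=> x /= xr i; rewrite /= in_itv/=.
  have := eucl_norm_coord (x - y) i; rewrite !mxE => h.
  by have := le_lt_trans h xr; rewrite ltr_norml => /andP[h1 h2]; apply/andP; split; lra.
rewrite (lebesgue_rV_box (A := fun i => `[y ord0 i - r, y ord0 i + r]%classic))//.
suff: (0 <= \prod_(i < d) lebesgue_measure `[(y ord0 i - r)%R, (y ord0 i + r)%R] < +oo)%E.
  by move=> /andP[].
elim/big_ind : _ => [|a b /andP[a0 aoo] /andP[b0 boo]|i _].
- by rewrite lee_fin ler01 ltry.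
- by rewrite mule_ge0// lte_mul_pinfty// ge0_fin_numE.
- rewrite measure_ge0/= lebesgue_measure_itv/=; case: ifP => _; last exact: ltry.
  by rewrite -EFinD ltry.
Qed.

Lemma indic_eball_L2 (y : 'rV[R]_d) (r : R) : L2 mu (\1_(eball y r) : 'rV[R]_d -> R).
Proof. by apply: L2_indic; [exact: measurable_eball|exact: eball_finite]. Qed.

Lemma indic_eball_L1 (y : 'rV[R]_d) (r : R) u : L2 mu u ->
  L1 mu (fun x => \1_(eball y r) x * u x).
Proof. by move=> Lu; apply: L2_L1M => //; exact: indic_eball_L2. Qed.

(** Finite intersections of coordinate half spaces, indexed by lists of pairs
    (coordinate, threshold): concatenation of lists makes them a pi-system
    containing the whole space. *)
Definition half_spaces (s : seq ('I_d * R)) : set 'rV[R]_d :=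
  [set x | all (fun p => p.2 < x ord0 p.1) s].

Lemma measurable_half_spaces s : measurable (half_spaces s).
Proof.
elim: s => [|[i c] s IH].
  by rewrite (_ : half_spaces [::] = setT)//; apply/seteqP; split.
rewrite (_ : half_spaces _ = ((fun x : 'rV[R]_d => x ord0 i) @^-1` `]c, +oo[) `&` half_spaces s).
  apply: measurableI => //; rewrite -[X in measurable X]setTI.
  exact: (measurable_coord i measurableT (measurable_itv _)).
apply/seteqP; split => x; rewrite /half_spaces /= in_itv/= andbT.
  by move=> /andP[].
by move=> [-> ->].
Qed.

Lemma half_spaces_setI : setI_closed (range half_spaces).
Proof.
move=> _ _ [s _ <-] [t _ <-]; exists (s ++ t) => //.
apply/seteqP; split => x; rewrite /half_spaces/= all_cat.
  by move=> /andP.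
by move=> [-> ->].
Qed.

Lemma half_spaces_generate (A : set 'rV[R]_d) : measurable A ->
  <<s range half_spaces >> A.
Proof.
move: A; apply: smallest_sub; first exact: smallest_sigma_algebra.
rewrite -bigcup_seq/=; apply: bigcup_sub => i _ _ [B mB <-] /=.
rewrite setTI.
have : (@ocitv R).-sigma.-measurable B by [].
rewrite RGenOInfty.measurableE; move: B {mB}.
apply: smallest_sub.
  have [g0 gC gU] := smallest_sigma_algebra [set: 'rV[R]_d] (range half_spaces).
  split => /=; first by rewrite preimage_set0.
  - by move=> A; rewrite setTD preimage_setC -setTD; exact: gC.
  - by move=> F mF; rewrite preimage_bigcup; exact: gU.
move=> _ [c ->]; apply: sub_sigma_algebra; exists [:: (i, c)] => //.
Qed.

End balls_and_half_spaces.

(** * Smooth functions that are flat at zero *)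

Section flat.
Context {R : realType}.
Implicit Types (p : {poly R}) (t : R).

(** The functions [p(1/t) exp(-1/t)], extended by zero to [t <= 0].  Keeping a
    polynomial factor makes the family stable under differentiation, so that
    smoothness follows from a single computation of derivative. *)
Definition flat p t : R := if 0 < t then p.[t^-1] * expR (- t^-1) else 0.

Lemma expr_expRN_le n (y : R) : 0 < y -> y ^+ n * expR (- y) <= (n.+1)`!%:R / y.
Proof.
move=> y0; have n0 : (0 : R) < (n.+1)`!%:R by rewrite ltr0n fact_gt0.
have := expR_ge1Dxn n (ltW y0).
rewrite expRN ler_pdivlMr// => h.
rewrite mulrAC -exprSr ler_pdivrMr ?expR_gt0// mulrC -ler_pdivrMr//.
by rewrite (le_trans _ h)// lerDr.
Qed.

(** The exponential beats every power of [1/t], with one power of [t] to spare;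
    applied to ['X * p] this is the vanishing of the derivative at 0. *)
Lemma flat_le_linear p : exists2 C, 0 <= C & forall t, `|flat p t| <= C * `|t|.
Proof.
exists (\sum_(i < size p) `|p`_i| * (i.+1)`!%:R).
  by apply: sumr_ge0 => i _; rewrite mulr_ge0.
move=> t; rewrite /flat; case: ifPn => t0; last by rewrite normr0 mulr_ge0// sumr_ge0// => i _; rewrite mulr_ge0.
rewrite horner_coef mulr_suml mulr_suml (le_trans (ler_norm_sum _ _ _))//.
apply: ler_sum => i _; rewrite -mulrA normrM -mulrA ler_wpM2l//.
have := expr_expRN_le i (y := t^-1); rewrite invr_gt0 invrK => /(_ t0) h.
rewrite ger0_norm; first by rewrite (gtr0_norm t0).
by rewrite mulr_ge0 ?expR_ge0// exprn_ge0// invr_ge0 ltW.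
Qed.

Lemma is_derive_flat p t : is_derive t 1 (flat p) (flat ('X^2 * (p - p^`())) t).
Proof.
have [t0|t0|<-{t}] := ltgtP 0 t.
- have tn0 : t != 0 by rewrite gt_eqF.
  have dV : is_derive t 1 (fun s : R => s^-1) (- t ^- 2).
    apply: DeriveDef; first exact: derivableV.
    by rewrite deriveV// derive_id; exact: mulr1.
  have d1 := is_derive1_comp (is_derive_poly p t^-1) dV.
  have dVN : is_derive t 1 (fun s : R => - s^-1) (t ^- 2).
    by rewrite -[t ^- 2]opprK; exact: is_deriveN.
  have d2 := @is_derive1_comp _ expR (fun s => - s^-1) _ _ _ (is_derive_expR (- t^-1)) dVN.
  have H : is_derive t 1 (fun s => p.[s^-1] * expR (- s^-1))
     (flat ('X^2 * (p - p^`())) t).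
    apply: (is_derive_eq (is_deriveM d1 d2)).
    rewrite /flat t0 /= !hornerE /GRing.scale /= exprVn; ring.
  apply: near_eq_is_derive H.
  near=> s; have s0 : 0 < s by near: s; exact: lt_nbhsr.
  by rewrite /flat s0.
- have H : is_derive t 1 (cst 0) (flat ('X^2 * (p - p^`())) t).
    by rewrite /flat ltNge (ltW t0); exact: is_derive_cst.
  apply: near_eq_is_derive H.
  near=> s; have s0 : s < 0 by near: s; exact: lt_nbhsl.
  by rewrite /flat ltNge (ltW s0).
- have [C C0 HC] := flat_le_linear ('X * p).
  rewrite [X in is_derive _ _ _ X]/flat ltxx.
  suff H : h^-1 *: ((flat p \o shift 0) (h *: 1) - flat p 0) @[h --> 0^'] --> (0 : R).
    by apply: DeriveDef; [apply/cvg_ex; exists 0|exact: cvg_lim].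
  apply/cvgrPdist_le => e e0.
  near=> h; rewrite /= addr0 sub0r normrN [flat p 0]/flat ltxx subr0 [h *: 1]mulr1.
  have hn0 : h != 0 by near: h; exact: nbhs_dnbhs_neq.
  have hle : `|h| <= e / (C + 1).
    near: h; apply: dnbhs0_le; apply: divr_gt0 => //; lra.
  have -> : h^-1 *: flat p h = flat ('X * p) h.
    rewrite /flat; case: ifP; rewrite ?scaler0// => _.
    by rewrite hornerM hornerX -mulrA.
  apply: le_trans (HC _) _.
  rewrite ler_pdivlMr in hle; last lra.
  by have := normr_ge0 h; nra.
Unshelve. all: by end_near. Qed.

Lemma flat_ge0 t : 0 <= flat 1 t.
Proof. by rewrite /flat; case: ifP => // _; rewrite hornerC mul1r expR_ge0. Qed.

Lemma flat_le1 t : flat 1 t <= 1.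
Proof.
rewrite /flat; case: ifP => // t0; rewrite hornerC mul1r -expR0 ler_expR oppr_le0.
by rewrite invr_ge0 ltW.
Qed.

Lemma flat_neq0 p t : flat p t != 0 -> 0 < t.
Proof. by rewrite /flat; case: ifP => //; rewrite eqxx. Qed.

Lemma flat_cvg1 (a b : R) : 0 < a -> flat 1 (n%:R * a - b) @[n --> \oo] --> (1 : R).
Proof.
move=> a0.
have h : (n%:R * a - b : R) @[n --> \oo] --> +oo%R.
  apply/cvgryPge => A; near=> n.
  rewrite lerBrDr -ler_pdivrMr//; near: n; exact: nbhs_infty_ger.
have hi : (n%:R * a - b)^-1 @[n --> \oo] --> (0 : R).
  apply/cvgrPdist_le => e e0; near=> n.
  have n0 : e^-1 <= n%:R * a - b by near: n; move/cvgryPge : h; apply.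
  rewrite sub0r normrN normfV -[leRHS]invrK lef_pV2 ?posrE ?invr_gt0//.
    by rewrite (le_trans n0)// ler_norm.
  by rewrite normr_gt0 gt_eqF// (lt_le_trans _ n0)// invr_gt0.
have : expR (- (n%:R * a - b)^-1) @[n --> \oo] --> expR (- 0 : R).
  have hN : - (n%:R * a - b)^-1 @[n --> \oo] --> (- 0 : R) by apply: cvgN.
  exact: (continuous_cvg _ (@continuous_expR R (- 0)) hN).
rewrite oppr0 expR0; apply: cvg_trans; apply: near_eq_cvg; near=> n.
have n0 : 0 < n%:R * a - b by near: n; move/cvgryPgt : h; apply.
by rewrite /flat n0 hornerC mul1r.
Unshelve. all: by end_near. Qed.

End flat.

(** * An explicit class of smooth functions *)

Section directional.
Context {R : realType}.
Implicit Types V : normedModType R.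

(** Directional derivatives are ordinary derivatives along a line; this gives
    access to the one-dimensional chain rule. *)
Lemma is_derive_line V (f : V -> R) (x v : V) (l : R) :
  is_derive x v f l <-> is_derive (0 : R) 1 (fun h : R => f (h *: v + x)) l.
Proof.
have E : (fun h : R => h^-1 *: ((f \o shift x) (h *: v) - f x)) =
    (fun h : R => h^-1 *: (((fun h : R => f (h *: v + x)) \o shift 0) (h *: 1)
      - f (0 *: v + x))).
  by apply/funext => h /=; rewrite addr0 scale0r add0r [h *: 1]mulr1.
split => -[H1 H2]; apply: DeriveDef; move: H1 H2; rewrite /derivable /derive.
- by rewrite E.
- by move=> _; rewrite E.
- by rewrite -E.
- by move=> _; rewrite -E.
Qed.

Lemma is_derive_line_at V (f : V -> R) (x v : V) (t l : R) :
  is_derive (x + t *: v) v f l -> is_derive t 1 (fun s : R => f (x + s *: v)) l.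
Proof.
move=> /is_derive_line H; apply: (is_derive_line (fun s : R => f (x + s *: v)) t 1 l).2.
rewrite (_ : (fun h : R => f (x + (h *: 1 + t) *: v)) =
  (fun h : R => f (h *: v + (x + t *: v))))//.
by apply/funext => h; rewrite [h *: 1]mulr1 scalerDl addrCA.
Qed.

Lemma is_derive_comp1 V (g : R -> R) (f : V -> R) (x v : V) (a b : R) :
  is_derive (f x) 1 g a -> is_derive x v f b -> is_derive x v (g \o f) (a * b).
Proof.
move=> dg /is_derive_line df; apply/is_derive_line.
apply: (is_derive1_comp (f := g) (g := fun h : R => f (h *: v + x))).
by rewrite scale0r add0r.
Qed.

End directional.

Section elementary.
Context {R : realType} {d : nat}.
Implicit Types (f g : 'rV[R]_d -> R) (x : 'rV[R]_d).

(** A class of explicit functions stable under partial derivatives, translations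
    and cutoffs, large enough to contain the test functions that approximate
    indicator functions. *)
Inductive elementary : ('rV[R]_d -> R) -> Prop :=
| elementary_cst c : elementary (fun=> c)
| elementary_coord i : elementary (fun x => x ord0 i)
| elementaryD f g : elementary f -> elementary g -> elementary (fun x => f x + g x)
| elementaryM f g : elementary f -> elementary g -> elementary (fun x => f x * g x)
| elementary_flat p f : elementary f -> elementary (fun x => flat p (f x)).

Lemma continuous_flat (p : {poly R}) : continuous (flat p).
Proof.
move=> t; apply/differentiable_continuous/derivable1_diffP.
by have [] := is_derive_flat p t.
Qed.

Lemma elementary_continuous f : elementary f -> continuous f.
Proof.
elim=> [c|i|{}f g _ cf _ cg|{}f g _ cf _ cg|p {}f _ cf] x.
- exact: cst_continuous.
- exact: coord_continuous.
- exact: (cvgD (cf x) (cg x)).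
- exact: (cvgM (cf x) (cg x)).
- exact: (continuous_cvg _ (@continuous_flat p (f x)) (cf x)).
Qed.

Lemma is_derive_coord x v (i : 'I_d) :
  is_derive x v (fun x : 'rV[R]_d => x ord0 i) (v ord0 i).
Proof.
suff H : h^-1 *: (((fun x : 'rV[R]_d => x ord0 i) \o shift x) (h *: v) - x ord0 i)
    @[h --> 0^'] --> v ord0 i.
  by apply: DeriveDef; [apply/cvg_ex; exists (v ord0 i)|exact: cvg_lim].
apply: cvg_near_cst; near=> h.
have h0 : h != 0 by near: h; exact: nbhs_dnbhs_neq.
by rewrite /= !mxE addrK [LHS]mulrA mulVf// mul1r.
Unshelve. all: by end_near. Qed.

Lemma elementary_derive f : elementary f -> forall v, exists2 g, elementary g &
  forall x, is_derive x v f (g x).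
Proof.
elim=> [c|i|{}f g ef df eg dg|{}f g ef df eg dg|p {}f ef df] v.
- exists (fun=> 0); first exact: elementary_cst.
  by move=> x; exact: is_derive_cst.
- exists (fun=> v ord0 i); first exact: elementary_cst.
  by move=> x; exact: is_derive_coord.
- have [f' ef' df'] := df v; have [g' eg' dg'] := dg v.
  exists (fun x => f' x + g' x); first exact: elementaryD.
  by move=> x; exact: is_deriveD.
- have [f' ef' df'] := df v; have [g' eg' dg'] := dg v.
  exists (fun x => f x * g' x + g x * f' x).
    by apply: elementaryD; exact: elementaryM.
  by move=> x; exact: is_deriveM.
- have [f' ef' df'] := df v.
  exists (fun x => flat ('X^2 * (p - p^`())) (f x) * f' x).
    by apply: elementaryM => //; exact: elementary_flat.
  by move=> x; apply: is_derive_comp1; exact: is_derive_flat.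
Qed.

Lemma elementary_smooth f : elementary f -> smooth f.
Proof.
move=> ef s.
have es : elementary (foldr partial f s).
  elim: s => [//|i s /elementary_derive /(_ (delta_mx ord0 i)) [g eg dg]] /=.
  rewrite (_ : partial _ _ = g)//; apply/funext => x.
  by rewrite /partial; case: (dg x).
split; first exact: elementary_continuous.
move=> i x; have [g _ dg] := elementary_derive es (delta_mx ord0 i).
by case: (dg x).
Qed.

Lemma elementaryN f : elementary f -> elementary (fun x => - f x).
Proof.
move=> ef; have := elementaryM (elementary_cst (-1)) ef.
by congr elementary; apply/funext => x; rewrite mulN1r.
Qed.

Lemma elementaryB f g : elementary f -> elementary g -> elementary (fun x => f x - g x).
Proof. by move=> ef eg; apply: elementaryD => //; exact: elementaryN. Qed.

Lemma elementaryX f n : elementary f -> elementary (fun x => f x ^+ n).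
Proof.
move=> ef; elim: n => [|n IH]; first exact: elementary_cst.
by under eq_fun do rewrite exprS; exact: elementaryM.
Qed.

Lemma elementary_sum (I : Type) (s : seq I) (F : I -> 'rV[R]_d -> R) :
  (forall i, elementary (F i)) -> elementary (fun x => \sum_(i <- s) F i x).
Proof.
move=> eF; elim: s => [|i s IH].
  by under eq_fun do rewrite big_nil; exact: elementary_cst.
by under eq_fun do rewrite big_cons; exact: elementaryD.
Qed.

Lemma elementary_prod (I : Type) (s : seq I) (F : I -> 'rV[R]_d -> R) :
  (forall i, elementary (F i)) -> elementary (fun x => \prod_(i <- s) F i x).
Proof.
move=> eF; elim: s => [|i s IH].
  by under eq_fun do rewrite big_nil; exact: elementary_cst.
by under eq_fun do rewrite big_cons; exact: elementaryM.
Qed.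

Lemma elementary_shift f h : elementary f -> elementary (fun x => f (x + h)).
Proof.
elim=> [c|i|{}f g _ ef _ eg|{}f g _ ef _ eg|p {}f _ ef].
- exact: elementary_cst.
- under eq_fun do rewrite mxE.
  by apply: elementaryD; [exact: elementary_coord|exact: elementary_cst].
- exact: (elementaryD ef eg).
- exact: (elementaryM ef eg).
- exact: (elementary_flat p ef).
Qed.

Lemma elementary_sqr_dist y : elementary (fun x => eucl_norm (x - y) ^+ 2).
Proof.
under eq_fun do rewrite sqr_eucl_norm.
apply: elementary_sum => i; apply: elementaryX; under eq_fun do rewrite !mxE.
by apply: elementaryB; [exact: elementary_coord|exact: elementary_cst].
Qed.

End elementary.

(** * Test functions and their density *)

Section test_functions.
Context {R : realType} {d : nat}.
Notation mu := (lebesgue_rV R d).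
Implicit Types (f phi psi : 'rV[R]_d -> R) (x y : 'rV[R]_d) (r rho : R).
Implicit Types B : set 'rV[R]_d.

Lemma continuous_eucl_norm y : continuous (fun x : 'rV[R]_d => eucl_norm (x - y)).
Proof.
move=> x; rewrite (_ : (fun x => _) = (@Num.sqrt R) \o (fun x => eucl_norm (x - y) ^+ 2)).
  exact: (continuous_cvg _ (@sqrt_continuous R _)
    (elementary_continuous (elementary_sqr_dist y) (x := x))).
by apply/funext => z /=; rewrite sqrtr_sqr ger0_norm// eucl_norm_ge0.
Qed.

Lemma closed_eucl_ball y rho : closed [set x : 'rV[R]_d | eucl_norm (x - y) <= rho].
Proof.
rewrite (_ : [set x | _] = (fun x => eucl_norm (x - y)) @^-1` [set t | t <= rho])//.
apply: closed_comp; last exact: closed_le.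
by move=> x _; exact: continuous_eucl_norm.
Qed.

Lemma compact_eucl_ball y rho : compact [set x : 'rV[R]_d | eucl_norm (x - y) <= rho].
Proof.
apply: bounded_closed_compact; last exact: closed_eucl_ball.
exists (`|rho| + `|y|); split; first exact: num_real.
move=> M hM x /= xy; apply/ltW/(le_lt_trans _ hM).
rewrite -[x](subrK y) (le_trans (ler_normD _ _))// lerD2r.
rewrite {1}/Num.norm/= mx_normrE; apply: bigmax_le => // -[i j] _ /=.
rewrite (ord1 i) (le_trans (eucl_norm_coord _ _))// (le_trans xy)//.
exact: ler_norm.
Qed.

(** Elementary test functions on a ball.  Asking the support to lie in a strictly
    smaller closed ball makes the class visibly stable under sums and makes
    the supports compact. *)
Definition bump y r phi := elementary phi /\
  exists2 rho, rho < r & forall x, phi x != 0 -> eucl_norm (x - y) <= rho.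

Lemma bump_test y r phi B : eball y r `<=` B -> bump y r phi -> test_function B phi.
Proof.
move=> rB [ephi [rho rhor supp]].
have clo : closure [set x | phi x != 0] `<=` [set x | eucl_norm (x - y) <= rho].
  rewrite [X in _ `<=` X](closure_id _).1; last exact: closed_eucl_ball.
  exact: closureS.
split; first exact: elementary_smooth.
- apply: subclosed_compact clo; first exact: closed_closure.
  exact: compact_eucl_ball.
- by apply: subset_trans clo _ => x /= xr; apply: rB; exact: le_lt_trans rhor.
Qed.

Lemma bump0 y r : bump y r (fun=> 0).
Proof.
split; first exact: elementary_cst.
by exists (r - 1); [lra|move=> x; rewrite eqxx].
Qed.

Lemma bumpD y r phi psi : bump y r phi -> bump y r psi ->
  bump y r (fun x => phi x + psi x).
Proof.
move=> [e1 [r1 h1 s1]] [e2 [r2 h2 s2]]; split; first exact: elementaryD.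
exists (Num.max r1 r2); first by rewrite gt_max h1 h2.
move=> x; have [->|p1 _] := eqVneq (phi x) 0; last by rewrite le_max s1.
by rewrite add0r => /s2 h; rewrite le_max h orbT.
Qed.

Lemma bumpM y r f phi : elementary f -> bump y r phi -> bump y r (fun x => f x * phi x).
Proof.
move=> ef [e1 [r1 h1 s1]]; split; first exact: elementaryM.
by exists r1 => // x; rewrite mulf_eq0 negb_or => /andP[_]; exact: s1.
Qed.

Lemma bump_shift y r phi h : bump y r phi -> bump (y - h) r (fun x => phi (x + h)).
Proof.
move=> [e1 [r1 h1 s1]]; split; first exact: elementary_shift.
exists r1 => // x /s1; congr (eucl_norm _ <= _).
by rewrite opprB addrA addrAC.
Qed.

Lemma bump_eball y r phi x : bump y r phi -> phi x != 0 -> eball y r x.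
Proof. by move=> [_ [rho rhor s]] /s h; exact: le_lt_trans rhor. Qed.

Lemma bounded_on_compact f (K : set 'rV[R]_d) : continuous f -> compact K ->
  exists2 M : R, 0 <= M & forall x, K x -> `|f x| <= M.
Proof.
move=> cf cK; have := continuous_compact (continuous_subspaceT cf) cK.
move=> /compact_bounded [M [_ HM]].
exists (`|M| + 1); first by rewrite addr_ge0.
move=> x Kx; apply: HM; first by rewrite (le_lt_trans (ler_norm _))// ltrDl.
by exists x.
Qed.

Lemma smooth_continuous phi : smooth phi -> continuous phi.
Proof. by move=> /(_ [::])[]. Qed.

Lemma smooth_partial_continuous phi i : smooth phi -> continuous (partial i phi).
Proof. by move=> /(_ [:: i])[]. Qed.

Lemma test_function_bounded B phi : test_function B phi ->
  exists2 M : R, 0 <= M & forall x, `|phi x| <= M.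
Proof.
move=> [/smooth_continuous cphi K _]; have [M M0 HM] := bounded_on_compact cphi K.
exists M => // x; have [->|p] := eqVneq (phi x) 0; first by rewrite normr0.
by apply: HM; exact: subset_closure.
Qed.

Lemma test_function_out B phi x : test_function B phi -> ~ B x -> phi x = 0.
Proof.
move=> [_ _ sB] nBx; have [//|p] := eqVneq (phi x) 0.
by case: nBx; apply: sB; exact: subset_closure.
Qed.

Lemma test_function_L2 y (r : R) phi : test_function (eball y r) phi -> L2 mu phi.
Proof.
move=> tphi; have [M M0 HM] := test_function_bounded tphi.
have [sphi _ _] := tphi.
have mphi : measurable_fun setT phi.
  by apply: continuous_measurable_rV; exact: smooth_continuous.
have mE := measurable_eball y r.
apply: (L2_le mphi (L2Z M (L2_indic mE (eball_finite y r)))) => x.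
rewrite normrM (ger0_norm M0) indicE.
have [yx|yx] := pselect (eball y r x); last first.
  by rewrite (test_function_out tphi)// normr0 mulr_ge0.
by rewrite mem_set// normr1 mulr1.
Qed.

Lemma bump_L2 y r phi : bump y r phi -> L2 mu phi.
Proof.
by move=> bphi; apply: (@test_function_L2 y r); exact: (bump_test _ bphi).
Qed.

(** The truncations [flat 1 (n (r^2 - |x - y|^2) - 1)] converge to the
    indicator function of the open ball, each with support in a smaller ball. *)
Lemma bump_cutoff y r n : 0 < r -> bump y r
  (fun x => flat 1 (n.+1%:R * (r ^+ 2 - eucl_norm (x - y) ^+ 2) - 1)).
Proof.
move=> r0; split.
  apply: elementary_flat; apply: elementaryB; last exact: elementary_cst.
  apply: elementaryM; first exact: elementary_cst.
  by apply: elementaryB; [exact: elementary_cst|exact: elementary_sqr_dist].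
have n0 : (0 : R) < n.+1%:R^-1 by rewrite invr_gt0.
exists (Num.sqrt (r ^+ 2 - n.+1%:R^-1)).
  have rE : r = Num.sqrt (r ^+ 2) by rewrite sqrtr_sqr gtr0_norm.
  rewrite [ltRHS]rE ltr_sqrt ?exprn_gt0// ?ltrBlDr ?ltrDl//.
move=> x /flat_neq0; rewrite subr_gt0 mulrC -ltr_pdivrMr// mul1r => h.
have sE : eucl_norm (x - y) = Num.sqrt (eucl_norm (x - y) ^+ 2).
  by rewrite sqrtr_sqr ger0_norm// eucl_norm_ge0.
rewrite [leLHS]sE ler_wsqrtr//; move: h; set k := _^-1 => h; lra.
Qed.

(** Smooth functions that converge to the indicator function of a finite
    intersection of half spaces. *)
Definition half_space_bump (s : seq ('I_d * R)) n x : R :=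
  \prod_(p <- s) flat 1 (n%:R * (x ord0 p.1 - p.2)).

Lemma half_space_bump_elementary s n : elementary (half_space_bump s n).
Proof.
apply: elementary_prod => p; apply: elementary_flat; apply: elementaryM.
  exact: elementary_cst.
by apply: elementaryB; [exact: elementary_coord|exact: elementary_cst].
Qed.

Lemma half_space_bump_itv s n x : 0 <= half_space_bump s n x <= 1.
Proof.
rewrite /half_space_bump; elim/big_ind : _ => //; first by rewrite ler01 lexx.
  by move=> a b /andP[a0 a1] /andP[b0 b1]; rewrite mulr_ge0// mulr_ile1.
by move=> p _; rewrite flat_ge0 flat_le1.
Qed.

Lemma half_space_bump_cvg s x :
  half_space_bump s n x @[n --> \oo] --> (\1_(half_spaces s) x : R).
Proof.
rewrite indicE (_ : (x \in _) = all (fun p => p.2 < x ord0 p.1) s); last first.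
  by apply/idP/idP => [/set_mem//|h]; exact: mem_set.
elim: s => [|[i c] s IH] /=.
  by under eq_fun do rewrite /half_space_bump big_nil; exact: cvg_cst.
under eq_fun do rewrite /half_space_bump big_cons /=.
rewrite -mulnb natrM; apply: cvgM => //.
have [ci|ic] := ltP c (x ord0 i).
  have := @flat_cvg1 _ (x ord0 i - c) 0; rewrite subr_gt0 => /(_ ci).
  by under eq_fun do rewrite subr0.
rewrite (_ : (fun _ => _) = cst 0); first exact: cvg_cst.
apply/funext => n /=; apply/eqP/negPn/negP => /flat_neq0.
by rewrite ltNge mulr_ge0_le0// subr_le0.
Qed.

(** By [L2_dense] it suffices to approximate the indicator of the ball cut by
    finitely many half spaces, and the products of the two kinds of cutoffs
    converge to it while staying below the indicator of the ball. *)
Lemma bump_dense y r f : 0 < r -> L2 mu f ->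
  approximable mu (bump y r) (fun x => \1_(eball y r) x * f x).
Proof.
move=> r0 Lf.
have mE := measurable_eball y r; have E_fin := eball_finite y r.
apply: (L2_dense (bump_L2 (y := y) (r := r)) (bump0 y r) _ _ mE E_fin
  half_spaces_setI half_spaces_generate) => //.
- by move=> phi psi; exact: bumpD.
- by move=> k phi; apply: bumpM; exact: elementary_cst.
- by move=> _ [s _ <-]; exact: measurable_half_spaces.
- by exists [::] => //; apply/seteqP; split.
move=> _ [s _ <-].
pose eta n x := flat 1 (n.+1%:R * (r ^+ 2 - eucl_norm (x - y) ^+ 2) - 1).
apply: (@approximable_cvg _ _ _ _ _ (bump_L2 (y := y) (r := r))
  (fun n x => half_space_bump s n x * eta n x) _ (\1_(eball y r))).
- move=> n; apply: approximableV; first exact: bump_L2.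
  by apply: bumpM; [exact: half_space_bump_elementary|exact: bump_cutoff].
- by apply: measurable_funM; apply: measurable_indic => //; exact: measurable_half_spaces.
- exact: L2_indic.
- move=> n x; have /andP[h0 h1] := half_space_bump_itv s n x.
  rewrite normrM (ger0_norm h0) (ger0_norm (flat_ge0 _)) -/(eta n x).
  have [->|/(bump_eball (bump_cutoff y n r0)) yx] := eqVneq (eta n x) 0.
    by rewrite mulr0.
  by rewrite indicE mem_set// normr1 mulr_ile1// ?flat_ge0// flat_le1.
- move=> x; rewrite mulrC; apply: cvgM; first exact: half_space_bump_cvg.
  have [yx|yx] := pselect (eball y r x).
    rewrite indicE mem_set//; have := @flat_cvg1 _ (r ^+ 2 - eucl_norm (x - y) ^+ 2) 1.
    rewrite subr_gt0 ltrXn2r ?nnegrE ?eucl_norm_ge0// ?ltW// => /(_ isT).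
    by rewrite -cvg_shiftS.
  rewrite indicE memNset// (_ : (fun _ => _) = cst 0); first exact: cvg_cst.
  apply/funext => n; apply/eqP/negPn/negP => /(bump_eball (bump_cutoff y n r0)).
  exact: yx.
Qed.

End test_functions.

(** * Translations and weak derivatives *)

Section translated_test_functions.
Context {R : realType} {d : nat}.
Notation mu := (lebesgue_rV R d).
Implicit Types (phi : 'rV[R]_d -> R) (x y : 'rV[R]_d) (B : set 'rV[R]_d).

Definition evec (i : 'I_d) : 'rV[R]_d := delta_mx ord0 i.

Lemma smooth_is_derive phi i x : smooth phi -> is_derive x (evec i) phi (partial i phi x).
Proof. by move=> /(_ [::])[_ /(_ i x) h]; apply: DeriveDef. Qed.

Lemma partial_out_support phi i x : ~ closure [set x | phi x != 0] x ->
  partial i phi x = 0.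
Proof.
move=> ncx.
have : nbhs x (~` closure [set x | phi x != 0]).
  by apply: open_nbhs_nbhs; split => //; apply: closed_openC; exact: closed_closure.
move=> H; have d0 : is_derive x (evec i) phi 0.
  have d0 : is_derive x (evec i) (cst (0 : R)) 0 by exact: is_derive_cst.
  apply: near_eq_is_derive d0; near=> z.
  have : (~` closure [set x | phi x != 0]) z by near: z.
  have [->//|p] := eqVneq (phi z) 0.
  by move=> nc; case: nc; exact: subset_closure.
by case: d0.
Unshelve. all: by end_near. Qed.

Lemma test_function_partial_bounded B phi i : test_function B phi ->
  exists2 M : R, 0 <= M & forall x, `|partial i phi x| <= M.
Proof.
move=> [/(smooth_partial_continuous (i := i)) cphi K _].
have [M M0 HM] := bounded_on_compact cphi K.
exists M => // x; have [Kx|Kx] := pselect (closure [set x | phi x != 0] x).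
  exact: HM.
by rewrite partial_out_support// normr0.
Qed.

(** Differentiation under the integral sign; [f] is integrable and the derivative
    of a test function is bounded, which provides the dominating function. *)
Lemma is_derive_translate (f : 'rV[R]_d -> R) B phi (i : 'I_d) (s : R) : L1 mu f ->
  test_function B phi ->
  is_derive s 1 (fun t : R => \int[mu]_x (f x * phi (x + t *: evec i)))
    (\int[mu]_x (f x * partial i phi (x + s *: evec i))).
Proof.
move=> If tphi; have [sphi _ _] := tphi.
have [M M0 HM] := test_function_bounded tphi.
have [N N0 HN] := test_function_partial_bounded i tphi.
have mf := L1_measurable If.
have mphi : measurable_fun setT phi by apply: continuous_measurable_rV; apply: smooth_continuous.
have d1 (t : R) x : is_derive t 1 (fun t : R => f x * phi (x + t *: evec i))
    (f x * partial i phi (x + t *: evec i)).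
  have h := is_derive_line_at (@smooth_is_derive phi i (x + t *: evec i) sphi).
  exact: (is_deriveZ (f x) h).
have int (t : R) : L1 mu (fun x => f x * phi (x + t *: evec i)).
  apply: (@L1_le _ _ _ _ _ (fun x => M * `|f x|)).
  - apply: measurable_funM => //; apply: measurableT_comp => //.
    exact: measurable_shift.
  - exact/L1Z/L1_norm.
  - by move=> x; rewrite normrM mulrC ler_wpM2r.
have Is : (`](s - 1), (s + 1)[%classic : set R) s by rewrite /= in_itv/=; apply/andP; split; lra.
have E (t : R) x : partial1of2 (fun (t : R) x => f x * phi (x + t *: evec i)) t x =
   f x * partial i phi (x + t *: evec i).
  by rewrite partial1of2E; case: (d1 t x).
have H : h^-1 *: ((fun t : R => \int[mu]_x (f x * phi (x + t *: evec i))) (h + s)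
    - (fun t : R => \int[mu]_x (f x * phi (x + t *: evec i))) s) @[h --> 0^'] -->
    \int[mu]_x (f x * partial i phi (x + s *: evec i)).
  under [X in _ --> X]eq_Rintegral do rewrite -E.
  apply: (@cvg_differentiation_under_integral R _ _ mu
    (fun (t : R) x => f x * phi (x + t *: evec i)) setT measurableT s (s - 1) (s + 1) Is
    (fun t _ => int t) _ (fun x => N * `|f x|)).
  - by move=> t x _ _; case: (d1 t x).
  - by move=> x; rewrite mulr_ge0.
  - exact/L1Z/L1_norm.
  - by move=> t x _ _; rewrite E normrM mulrC ler_wpM2r.
by apply: DeriveDef; rewrite /derivable /derive;
  under eq_fun do rewrite /= [_ *: 1]mulr1; [apply/cvg_ex; eexists; exact: H|exact: cvg_lim].
Qed.

End translated_test_functions.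

Section translation_estimate.
Context {R : realType} {d : nat}.
Notation mu := (lebesgue_rV R d).
Implicit Types (phi f g : 'rV[R]_d -> R) (x y : 'rV[R]_d) (B D : set 'rV[R]_d).

(** The weak derivative in direction [i] of a function extended by zero. *)
Definition weak_partial B i f g := forall phi, test_function B phi ->
  ip mu f (partial i phi) = - ip mu g phi.

Lemma ip_indic_bump y r f phi : bump y r phi ->
  ip mu (fun x => \1_(eball y r) x * f x) phi = ip mu f phi.
Proof.
move=> bphi; apply: eq_Rintegral => x _.
have [->|p] := eqVneq (phi x) 0; first by rewrite !mulr0.
by rewrite indicE mem_set ?mul1r//; exact: (bump_eball bphi p).
Qed.

Lemma partial_shift phi i h x :
  partial i (fun z => phi (z + h)) x = partial i phi (x + h).
Proof.
rewrite /partial /derive.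
rewrite (_ : (fun t : R => t^-1 *: (((fun z => phi (z + h)) \o shift x)
    (t *: delta_mx ord0 i) - phi (x + h))) =
  (fun t : R => t^-1 *: ((phi \o shift (x + h)) (t *: delta_mx ord0 i) - phi (x + h))))//.
by apply/funext => t /=; rewrite addrA.
Qed.

(** Duality: testing against functions close to [f] on the ball.  The hypothesis
    is the Young form of [|ip f phi| <= sqrt K * sqrt (nsq phi)], and for [phi]
    near [f] it leaves [nsq f <= K]. *)
Lemma nsq_le_dual y r f (K : R) : 0 < r -> L2 mu f ->
  (forall phi, bump y r phi -> 2 * ip mu f phi <= K + nsq mu phi) ->
  nsq mu (fun x => \1_(eball y r) x * f x) <= K.
Proof.
move=> r0 Lf H; set a := fun x => _.
have La : L2 mu a := L2_restrict (measurable_eball y r) Lf.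
apply/ler_addgt0Pr => e e0.
have [phi bphi] := (bump_dense y r0 Lf).2 _ e0.
have Lphi := bump_L2 bphi.
have := H _ bphi; rewrite -(ip_indic_bump f bphi) -/a.
rewrite /nsq ipBl ?ipBr//; last exact: L2B.
rewrite (ipC _ phi a); lra.
Qed.

(** Against a bump [phi] supported in the ball, the difference
    [f(. + h e_i) - f] is the variation between [-h] and 0 of the function
    [s |-> int f phi(. + s e_i)].  By definition of the weak derivative, the
    derivative of this function at [s] is minus the integral of [g] against a
    translate of [phi] whose support is still in [D]; the mean value theorem
    and duality conclude. *)
Lemma translation_estimate B D i f g y (r h : R) : 0 < r -> 0 <= h ->
  measurable D -> L1 mu f -> L2 mu f -> L2 mu g -> weak_partial B i f g ->
  D `<=` B -> (forall s : R, 0 <= s <= h -> eball (y + s *: evec i) r `<=` D) ->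
  nsq mu (fun x => \1_(eball y r) x * (f (x + h *: evec i) - f x)) <=
  h ^+ 2 * nsq mu (fun x => \1_D x * g x).
Proof.
move=> r0 h0 mD If Lf Lg fg DB yD.
have Lfh := L2_shift (h *: evec i) Lf.
apply: nsq_le_dual => //; first exact: L2B.
move=> phi bphi; have Lphi := bump_L2 bphi.
rewrite ipBl//.
have LDg : L2 mu (fun x => \1_D x * g x) by exact: L2_restrict.
have tphi : test_function (eball y r) phi by exact: (bump_test _ bphi).
pose F (t : R) := \int[mu]_x (f x * phi (x + t *: evec i)).
have -> : ip mu (fun x => f (x + h *: evec i)) phi = F (- h).
  rewrite /F -(Rintegral_shift (h *: evec i)).
    by apply: eq_Rintegral => x _; rewrite scaleNr addrK.
  exact: (L2_L1M Lf (L2_shift _ Lphi)).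
have -> : ip mu f phi = F 0.
  by apply: eq_Rintegral => x _; rewrite scale0r addr0.
have dF (s : R) : is_derive s 1 F (\int[mu]_x (f x * partial i phi (x + s *: evec i))).
  exact: is_derive_translate tphi.
have h0' : - h <= 0 by rewrite oppr_le0.
have cF : {within `[- h, 0], continuous F}.
  by apply: derivable_within_continuous => s _; case: (dF s).
have [c chr FE] := MVT_segment h0' (fun s _ => dF s) cF.
move: chr; rewrite in_itv/= => /andP[hc c0].
pose phic x := phi (x + c *: evec i).
have bc : bump (y - c *: evec i) r phic by exact: bump_shift.
have cD : eball (y - c *: evec i) r `<=` D.
  by rewrite -scaleNr; apply: yD; apply/andP; split; lra.
have Lphic := bump_L2 bc.
have dc : F 0 - F (- h) = - h * ip mu (fun x => \1_D x * g x) phic.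
  rewrite FE sub0r opprK.
  have -> : \int[mu]_x (f x * partial i phi (x + c *: evec i)) = - ip mu g phic.
    rewrite -fg; last by apply: bump_test bc; exact: subset_trans DB.
    apply: eq_Rintegral => x _; congr (_ * _).
    by rewrite /phic partial_shift.
  rewrite !mulNr; congr (- _); rewrite mulrC; congr (_ * _).
  apply: eq_Rintegral => x _.
  have [->|p] := eqVneq (phic x) 0; first by rewrite !mulr0.
  rewrite indicE mem_set ?mul1r//; apply: cD; exact: (bump_eball bc p).
have -> : F (- h) - F 0 = ip mu (fun x => h * (\1_D x * g x)) phic.
  by rewrite ipZl// -[LHS]opprB dc mulNr opprK.
have := ip_young (k := 1) ltr01 (L2Z h LDg) Lphic.
have -> : nsq mu phic = nsq mu phi by exact: ip_shift.
rewrite invr1 !mul1r nsqZ//; apply: le_trans.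
by rewrite ler_pM2l// ler_norm.
Qed.

End translation_estimate.

(** * Difference quotients and the chain rule *)

Section difference_quotients.
Context {R : realType} {d : nat}.
Notation mu := (lebesgue_rV R d).
Implicit Types (phi psi f g v : 'rV[R]_d -> R) (x y : 'rV[R]_d).

(** Strong convergence in [L^2] implies weak convergence. *)
Lemma ip_cvg (f_ : nat -> 'rV[R]_d -> R) f psi : (forall n, L2 mu (f_ n)) ->
  L2 mu f -> L2 mu psi -> nsq mu (fun x => f_ n x - f x) @[n --> \oo] --> 0 ->
  ip mu (f_ n) psi @[n --> \oo] --> ip mu f psi.
Proof.
move=> Lf_ Lf Lpsi h; apply/cvgrPdist_le => e e0.
have N0 := nsq_ge0 mu psi.
have e1 : 0 < e / (nsq mu psi + 1) by apply: divr_gt0 => //; lra.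
have e2 : 0 < e * (e / (nsq mu psi + 1)) by exact: mulr_gt0.
near=> n.
have hn : nsq mu (fun x => f_ n x - f x) <= e * (e / (nsq mu psi + 1)).
  by rewrite (le_trans (ler_norm _))//; near: n; apply: cvgr0_norm_le.
rewrite distrC -ipBl//.
have := ip_young (k := (e / (nsq mu psi + 1))^-1) _ (L2B (Lf_ n) Lf) Lpsi.
rewrite invr_gt0 => /(_ e1); rewrite invrK.
have : (e / (nsq mu psi + 1))^-1 * nsq mu (fun x => f_ n x - f x) <= e.
  by rewrite ler_pdivrMl// mulrC.
have : e / (nsq mu psi + 1) * nsq mu psi <= e.
  by rewrite mulrAC ler_pdivrMr; [nra|lra].
lra.
Unshelve. all: by end_near. Qed.

Lemma test_function_partial_L2 y (r : R) phi i : test_function (eball y r) phi ->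
  L2 mu (partial i phi).
Proof.
move=> tphi; have [M M0 HM] := test_function_partial_bounded i tphi.
have [sphi _ sB] := tphi.
have mphi : measurable_fun setT (partial i phi).
  by apply: continuous_measurable_rV; exact: smooth_partial_continuous.
have mE := measurable_eball y r.
apply: (L2_le mphi (L2Z M (L2_indic mE (eball_finite y r)))) => x.
rewrite normrM (ger0_norm M0) indicE.
have [yx|yx] := pselect (eball y r x); last first.
  rewrite partial_out_support ?normr0 ?mulr_ge0//.
  by move=> /sB.
by rewrite mem_set// normr1 mulr1.
Qed.

Lemma test_function_smaller_ball y (r0 : R) phi : 0 < r0 ->
  test_function (eball y r0) phi ->
  exists2 r : R, 0 < r < r0 & forall x, phi x != 0 -> eball y r x.
Proof.
move=> r00 [_ K sB].
have [K0|K0] := pselect (closure [set x | phi x != 0] !=set0); last first.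
  exists (r0 / 2) => [|x p]; first by apply/andP; split; lra.
  by case: K0; exists x; exact: subset_closure.
have cE : {within closure [set x | phi x != 0], continuous (fun x => eucl_norm (x - y))}.
  by apply: continuous_subspaceT; exact: continuous_eucl_norm.
have [c /set_mem Kc cmax] := compact_EVT_max K0 K cE.
have c0 := eucl_norm_ge0 (c - y); have cr0 : eucl_norm (c - y) < r0 by exact: sB.
exists ((eucl_norm (c - y) + r0) / 2) => [|x p]; first by apply/andP; split; lra.
have : x \in closure [set x | phi x != 0] by apply: mem_set; exact: subset_closure.
by move=> /cmax; rewrite /eball/=; lra.
Qed.

Definition diff_quot i (h : R) f x := h^-1 * (f (x + h *: evec i) - f x).

Lemma L2_diff_quot i h f : L2 mu f -> L2 mu (diff_quot i h f).
Proof. by move=> Lf; apply: L2Z; apply: L2B => //; exact: L2_shift. Qed.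

(** After a translation of the variable, this is the difference quotient at 0 of
    the differentiable function [t |-> int f phi(. + t e_i)]. *)
Lemma diff_quot_cvg B i f phi : L1 mu f -> L2 mu f -> L2 mu phi ->
  test_function B phi ->
  ip mu (diff_quot i h f) phi @[h --> (0 : R)^'+] --> - ip mu f (partial i phi).
Proof.
move=> If Lf Lphi tphi.
pose F (t : R) := \int[mu]_x (f x * phi (x + t *: evec i)).
have : is_derive (0 : R) 1 F (ip mu f (partial i phi)).
  apply: is_derive_eq (is_derive_translate i 0 If tphi) _.
  by apply: eq_Rintegral => x _; rewrite scale0r addr0.
rewrite -[X in is_derive X](oppr0) => dF.
have : is_derive (0 : R) 1 (F \o -%R) (ip mu f (partial i phi) * -1).
  by apply: is_derive1_comp; exact: is_deriveNid.
move=> [dc dv].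
have E (h : R) : h^-1 *: ((F \o -%R \o shift 0) (h *: 1) - (F \o -%R) 0) =
    ip mu (diff_quot i h f) phi.
  rewrite ipZl//; last by apply: L2B => //; exact: L2_shift.
  rewrite ipBl//; last exact: L2_shift.
  rewrite /= addr0 [h *: 1]mulr1 oppr0; congr (_ * (_ - _)).
    rewrite /F -(Rintegral_shift (h *: evec i)).
      by apply: eq_Rintegral => x _; rewrite scaleNr addrK.
    exact: (L2_L1M Lf (L2_shift _ Lphi)).
  by apply: eq_Rintegral => x _; rewrite scale0r addr0.
move: dc dv; rewrite /derivable /derive => dc dv.
have : h^-1 *: ((F \o -%R \o shift 0) (h *: 1) - (F \o -%R) 0) @[h --> 0^']
   --> - ip mu f (partial i phi).
  by have -> : - ip mu f (partial i phi) = ip mu f (partial i phi) * -1; [rewrite mulrN1|rewrite -dv].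
under eq_fun do rewrite E.
exact: cvg_dnbhs_at_right.
Qed.

End difference_quotients.

Section chain_rule.
Context {R : realType} {d : nat}.
Notation mu := (lebesgue_rV R d).
Implicit Types (phi psi f g v : 'rV[R]_d -> R) (x y : 'rV[R]_d).

Lemma eucl_norm_evec_le (s : R) (i : 'I_d) : eucl_norm (s *: evec i) <= `|s|.
Proof.
rewrite (le_trans (eucl_norm_le_sum _))// (bigD1 i)//= big1.
  by rewrite !mxE !eqxx mulr1 addr0.
by move=> j ji; rewrite !mxE (negbTE ji) andbF mulr0 normr0.
Qed.

(** The translation estimate, divided by [h ^ 2]. *)
Lemma nsq_diff_quot y (r0 r h : R) i f g : 0 < r -> 0 < h -> r + h <= r0 ->
  L1 mu f -> L2 mu f -> L2 mu g -> weak_partial (eball y r0) i f g ->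
  nsq mu (fun x => \1_(eball y r) x * diff_quot i h f x) <= nsq mu g.
Proof.
move=> r_gt0 h0 rh If Lf Lg fg.
have mB := measurable_eball y r0; have mE := measurable_eball y r.
have H : nsq mu (fun x => \1_(eball y r) x * (f (x + h *: evec i) - f x)) <=
    h ^+ 2 * nsq mu (fun x => \1_(eball y r0) x * g x).
  apply: (translation_estimate (B := eball y r0)) fg _ _ => //; first exact: ltW.
  move=> s /andP[s0 sh]; apply: sub_eball.
  rewrite [y + _]addrC addrK; apply: le_trans rh; rewrite [leLHS]addrC lerD2l.
  by rewrite (le_trans (eucl_norm_evec_le _ _))// ger0_norm.
rewrite (_ : (fun x => _) = (fun x => h^-1 * (\1_(eball y r) x * (f (x + h *: evec i) - f x)))).
  rewrite nsqZ; last by apply: L2_restrict => //; apply: L2B => //; exact: L2_shift.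
  rewrite exprVn ler_pdivrMl ?exprn_gt0//; apply: le_trans H _.
  rewrite ler_pM2l ?exprn_gt0//; apply: le_nsq => //; first exact: L2_restrict.
  move=> x; rewrite normrM indicE; case: (_ \in _).
    by rewrite normr1 mul1r.
  by rewrite normr0 mul0r.
by apply/funext => x; rewrite /diff_quot mulrCA.
Qed.

Variables (y : 'rV[R]_d) (r0 : R) (i : 'I_d) (f g : 'rV[R]_d -> R).
Hypotheses (r0_gt0 : 0 < r0) (If : L1 mu f) (Lf : L2 mu f) (Lg : L2 mu g).
Hypothesis fg : weak_partial (eball y r0) i f g.
Notation B := (eball y r0).

Section smooth_chain_rule.
Variables (beta beta' : R -> R) (L : R).
Hypotheses (mbeta' : measurable_fun setT beta') (beta'1 : forall a, `|beta' a| <= 1).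
Hypothesis L0 : 0 <= L.
Hypothesis taylor : forall a b, `|beta b - beta a - beta' a * (b - a)| <= L * (b - a) ^+ 2.
Let v x := \1_B x * beta (f x).
Hypotheses (Iv : L1 mu v) (Lv : L2 mu v).

(** Weak derivatives of [f] and of [beta(f)] are limits of difference quotients
    tested against [phi].  By Taylor's inequality the quotient of [beta(f)] is
    [beta'(f)] times that of [f], up to [L h] times the square of the quotient
    of [f], which is bounded in [L^1].  Since [beta'(f) phi] is merely in
    [L^2], the convergence of the quotient of [f] against it uses an
    approximation of it by bumps and the [L^2] bound on the quotients. *)
Lemma weak_partial_chain : weak_partial B i v (fun x => beta' (f x) * g x).
Proof.
move=> phi tphi.
have [r /andP[r_gt0 rr0] supp] := test_function_smaller_ball r0_gt0 tphi.
have [M M0 HM] := test_function_bounded tphi.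
have Lphi := test_function_L2 tphi.
have mE := measurable_eball y r.
have mf : measurable_fun setT f by exact: L2_measurable Lf.
have mb : measurable_fun setT (fun x => beta' (f x)) by exact: measurableT_comp.
pose psi x := beta' (f x) * phi x.
have Lpsi : L2 mu psi by exact: (L2Mb (k := 1)).
have Epsi : (fun x => \1_(eball y r) x * psi x) = psi.
  apply/funext => x; have [p|p] := eqVneq (phi x) 0; first by rewrite /psi p !mulr0.
  by rewrite indicE mem_set ?mul1r//; exact: supp.
have Lgb : L2 mu (fun x => beta' (f x) * g x) by exact: (L2Mb (k := 1)).
have -> : ip mu (fun x => beta' (f x) * g x) phi = ip mu g psi.
  by apply: eq_Rintegral => x _; rewrite /psi; ring.
set G := nsq mu g; have G0 : 0 <= G := nsq_ge0 mu g.
apply/eqP; rewrite -subr_eq0 opprK -normr_le0.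
apply/ler_addgt0Pr => e e0; rewrite add0r.
(* the parameter of Young's inequality: difference quotients contribute at
   most [4 G], and bumps are taken within [e / (4 k)] of [psi] *)
pose k := 16 * (G + 1) / e.
have k0 : 0 < k by rewrite divr_gt0// mulr_gt0//; lra.
have kE : k * e = 16 * (G + 1) by rewrite mulfVK// gt_eqF.
have ek : 0 < e / (4 * k) by rewrite divr_gt0// mulr_gt0.
have apsi : approximable mu (bump y r) psi by rewrite -Epsi; exact: bump_dense.
have [psi' bpsi' Hpsi'] := apsi.2 _ ek.
have Lpsi' := bump_L2 bpsi'.
have tpsi' : test_function B psi'.
  by apply: bump_test bpsi'; apply: sub_eball; rewrite subrr eucl_norm0 add0r ltW.
have c1 := diff_quot_cvg (i := i) Iv Lv Lphi tphi.
have c2 := diff_quot_cvg (i := i) If Lf Lpsi' tpsi'.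
rewrite (fg tpsi') opprK in c2.
have e4 : 0 < e / 4 by rewrite divr_gt0.
near (0 : R)^'+ => h.
have h0 : 0 < h by near: h; exact: nbhs_right_gt.
have h1 : r + h <= r0.
  by rewrite -lerBrDl; near: h; apply: nbhs_right_le; rewrite subr_gt0.
have h2 : h <= e / (4 * (L * M * G + 1)).
  near: h; apply: nbhs_right_le; rewrite divr_gt0// mulr_gt0//.
  by rewrite ltr_wpDl// !mulr_ge0.
have A1 : `|ip mu (diff_quot i h v) phi + ip mu v (partial i phi)| <= e / 4.
  have : `|- ip mu v (partial i phi) - ip mu (diff_quot i h v) phi| <= e / 4.
    by near: h; move/cvgrPdist_le : c1; apply.
  by rewrite -opprD normrN addrC.
have A2 : `|ip mu (diff_quot i h f) psi' - ip mu g psi'| <= e / 4.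
  by rewrite distrC; near: h; move/cvgrPdist_le : c2; apply.
have Lqf := L2_diff_quot i h Lf; have Lqv := L2_diff_quot i h Lv.
have nq := nsq_diff_quot r_gt0 h0 h1 If Lf Lg fg; rewrite -/G in nq.
have LEq : L2 mu (fun x => \1_(eball y r) x * diff_quot i h f x) by exact: L2_restrict.
have LEg : L2 mu (fun x => \1_(eball y r) x * g x) by exact: L2_restrict.
have A3 : `|ip mu (diff_quot i h v) phi - ip mu (diff_quot i h f) psi| <= e / 4.
  have I1 := L2_L1M Lqv Lphi; have I2 := L2_L1M Lqf Lpsi.
  rewrite /ip -RintegralB//.
  apply: le_trans (le_normr_Rintegral _ _) _ => //; first exact: (L1B I1 I2).
  have I3 : L1 mu (fun x => L * M * h * (\1_(eball y r) x * diff_quot i h f x) ^+ 2).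
    by apply: L1Z; case: LEq.
  apply: (@le_trans _ _ (L * M * h * G)); last first.
    rewrite (_ : L * M * h * G = h * (L * M * G)); last by ring.
    have LMG : 0 <= L * M * G by rewrite !mulr_ge0.
    rewrite ler_pdivlMr in h2; last by rewrite mulr_gt0//; lra.
    by rewrite ler_pdivlMr//; nra.
  apply: (@le_trans _ _ (L * M * h *
      nsq mu (fun x => \1_(eball y r) x * diff_quot i h f x))); last first.
    by rewrite ler_wpM2l// !mulr_ge0// ltW.
  rewrite nsqE -RintegralZl//; last by case: LEq.
  apply: le_Rintegral => //; first by apply: L1_norm; exact: (L1B I1 I2).
  move=> x _; have [p|p] := eqVneq (phi x) 0.
    by rewrite /psi p !mulr0 subr0 normr0 mulr_ge0 ?sqr_ge0// !mulr_ge0// ltW.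
  have xE := supp _ p.
  have xB : B x by exact: (lt_trans xE rr0).
  have xhB : B (x + h *: evec i).
    apply: lt_le_trans h1; rewrite /= addrAC (le_lt_trans (ler_eucl_normD _ _))//.
    have hh : eucl_norm (h *: evec i) <= h.
      by rewrite (le_trans (eucl_norm_evec_le _ _))// gtr0_norm.
    exact: ltr_leD xE hh.
  rewrite /v /diff_quot /psi !indicE !mem_set// !mul1r.
  have := taylor (f x) (f (x + h *: evec i)); have := HM x.
  set D := f (x + _) - f x; set bb := beta (f (x + _)) - _ => Mx T.
  rewrite (_ : _ - _ = (h^-1 * phi x) * (bb - beta' (f x) * D)); last by ring.
  rewrite (_ : L * M * h * _ = (h^-1 * M) * (L * D ^+ 2) * (h^-1 * h)); last by ring.
  rewrite mulVf ?gt_eqF// mulr1 normrM ler_pM// normrM.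
  by rewrite gtr0_norm ?invr_gt0// ler_wpM2l// invr_ge0 ltW.
have A4 : `|ip mu (fun x => diff_quot i h f x - g x) (fun x => psi x - psi' x)| <= e / 4.
  have -> : ip mu (fun x => diff_quot i h f x - g x) (fun x => psi x - psi' x) =
    ip mu (fun x => \1_(eball y r) x * diff_quot i h f x - \1_(eball y r) x * g x)
      (fun x => psi x - psi' x).
    apply: eq_Rintegral => x _; rewrite -mulrBr.
    have [yx|yx] := pselect (eball y r x); first by rewrite indicE mem_set// mul1r.
    have [p'|p'] := eqVneq (psi' x) 0; last by case: yx; exact: bump_eball bpsi' p'.
    have [p|p] := eqVneq (phi x) 0; last by case: yx; exact: supp.
    by rewrite /psi p' p mulr0 subr0 !mulr0.
  have := ip_young (k := k^-1) _ (L2B LEq LEg) (L2B Lpsi Lpsi').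
  rewrite invr_gt0 invrK => /(_ k0).
  have nB : nsq mu (fun x => \1_(eball y r) x * diff_quot i h f x -
      \1_(eball y r) x * g x) <= 4 * G.
    have LEg' : L2 mu (fun x => -1 * (\1_(eball y r) x * g x)) by exact: L2Z.
    rewrite (_ : (fun x => _) = (fun x => \1_(eball y r) x * diff_quot i h f x +
      -1 * (\1_(eball y r) x * g x))); last by apply/funext => x; rewrite mulN1r.
    rewrite (le_trans (nsqD_le _ _))// nsqZ// sqrrN expr1n mul1r.
    have : nsq mu (fun x => \1_(eball y r) x * g x) <= G.
      apply: le_nsq => // x; rewrite normrM indicE; case: (_ \in _).
        by rewrite normr1 mul1r.
      by rewrite normr0 mul0r.
    lra.
  have b1 : k^-1 * nsq mu (fun x => \1_(eball y r) x * diff_quot i h f x -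
      \1_(eball y r) x * g x) <= e / 4.
    rewrite ler_pdivrMl//; apply: le_trans nB _.
    by rewrite mulrA kE; lra.
  have b2 : k * nsq mu (fun x => psi x - psi' x) <= e / 4.
    rewrite -ler_pdivlMl// (le_trans Hpsi')//.
    have -> : e / (4 * k) = k^-1 * (e / 4) by rewrite invfM; ring.
    by [].
  lra.
move: A1 A2 A3 A4; rewrite ipBl// ?ipBr//; last exact: L2B.
rewrite !ler_norml => /andP[? ?] /andP[? ?] /andP[? ?] /andP[? ?].
apply/andP; split; lra.
Unshelve. all: by end_near. Qed.

End smooth_chain_rule.
End chain_rule.

(** * The weak gradient of a positive part *)

Section positive_part.
Context {R : realType}.
Implicit Types (s t : R) (n : nat).

Definition ppart s := Num.max s 0.

(** A [C^{1,1}] approximation of the positive part from below: the function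
    [ppart ^ 2 / 2] has Lipschitz derivative [ppart], and this is its backward
    difference quotient with step [1 / (n + 1)]. *)
Definition smooth_ppart n s := n.+1%:R / 2 * (ppart s ^+ 2 - ppart (s - n.+1%:R^-1) ^+ 2).

(** The derivative of [smooth_ppart]. *)
Definition smooth_ppart' n s := n.+1%:R * (ppart s - ppart (s - n.+1%:R^-1)).

Lemma ppart_sqr_taylor s t :
  `|ppart t ^+ 2 - ppart s ^+ 2 - 2 * ppart s * (t - s)| <= (t - s) ^+ 2.
Proof.
rewrite /ppart; case: (lerP t 0) => ht; case: (lerP s 0) => hs; rewrite ler_norml.
- have := sqr_ge0 (t - s); rewrite !expr0n/= !(mulr0, mul0r, subr0) => h.
  by apply/andP; split; lra.
- have st : s * t <= 0 by rewrite mulr_ge0_le0// ltW.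
  by have t2 := sqr_ge0 t; have s2 := sqr_ge0 s; apply/andP; split; nra.
- have st : s * t <= 0 by rewrite mulr_le0_ge0// ltW.
  by have t2 := sqr_ge0 t; have s2 := sqr_ge0 s; apply/andP; split; nra.
- by apply/andP; split; have := sqr_ge0 (t - s); nra.
Qed.

Lemma smooth_ppart_taylor n s t :
  `|smooth_ppart n t - smooth_ppart n s - smooth_ppart' n s * (t - s)| <=
  n.+1%:R * (t - s) ^+ 2.
Proof.
have N0 : (0 : R) < n.+1%:R by [].
have h1 := ppart_sqr_taylor s t.
have h2 := ppart_sqr_taylor (s - n.+1%:R^-1) (t - n.+1%:R^-1).
rewrite (_ : t - n.+1%:R^-1 - (s - n.+1%:R^-1) = t - s) in h2; last by ring.
rewrite /smooth_ppart /smooth_ppart'.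
move: h1 h2 N0; set N := n.+1%:R; set a := ppart t; set b := ppart s.
set a' := ppart (t - _); set b' := ppart (s - _); set u := t - s => h1 h2 N0.
rewrite (_ : _ - _ = N / 2 * ((a ^+ 2 - b ^+ 2 - 2 * b * u) -
  (a' ^+ 2 - b' ^+ 2 - 2 * b' * u))); last by field.
rewrite normrM gtr0_norm ?divr_gt0//.
have := ler_normB (a ^+ 2 - b ^+ 2 - 2 * b * u) (a' ^+ 2 - b' ^+ 2 - 2 * b' * u).
set X := `|_ - (_ - _ - _)| => hX.
have : X <= 2 * u ^+ 2 by lra.
nra.
Qed.

Lemma smooth_ppart'_itv n s : 0 <= smooth_ppart' n s <= 1.
Proof.
have N0 : (0 : R) < n.+1%:R by [].
have e0 : (0 : R) < n.+1%:R^-1 by rewrite invr_gt0.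
have NE : n.+1%:R * n.+1%:R^-1 = 1 :> R by rewrite divff// gt_eqF.
rewrite /smooth_ppart' /ppart; move: NE N0 e0; set e := _^-1; set N := n.+1%:R => NE N0 e0.
by case: (lerP s 0) => hs; case: (lerP (s - e) 0) => hse; apply/andP; split; nra.
Qed.

Lemma smooth_ppart_itv n s : ppart s - n.+1%:R^-1 <= smooth_ppart n s <= ppart s.
Proof.
have N0 : (0 : R) < n.+1%:R by [].
have e0 : (0 : R) < n.+1%:R^-1 by rewrite invr_gt0.
have NE : n.+1%:R * n.+1%:R^-1 = 1 :> R by rewrite divff// gt_eqF.
rewrite /smooth_ppart /ppart; move: NE N0 e0; set e := _^-1; set N := n.+1%:R => NE N0 e0.
case: (lerP s 0) => hs; case: (lerP (s - e) 0) => hse.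
- by apply/andP; split; nra.
- by exfalso; lra.
- rewrite expr0n/= subr0; have : N * s <= 1 by nra.
  by move=> h; apply/andP; split; nra.
- have -> : N / 2 * (s ^+ 2 - (s - e) ^+ 2) = (N * e) * s - (N * e) * e / 2 by field.
  by rewrite NE; apply/andP; split; lra.
Qed.

Lemma smooth_ppart_ge0 n s : 0 <= smooth_ppart n s.
Proof.
have N0 : (0 : R) < n.+1%:R by [].
have e0 : (0 : R) < n.+1%:R^-1 by rewrite invr_gt0.
rewrite /smooth_ppart mulr_ge0// ?divr_ge0// subr_ge0.
rewrite lerXn2r ?nnegrE ?le_max ?lexx ?orbT//.
move: e0; set e := _^-1 => e0.
by rewrite /ppart; case: (lerP s 0) => hs; case: (lerP (s - e) 0) => hse; lra.
Qed.

Lemma cvg_smooth_ppart s : smooth_ppart n s @[n --> \oo] --> ppart s.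
Proof.
apply/cvgrPdist_le => e e0; near=> n.
have ne : (n.+1%:R)^-1 < e by near: n; exact: near_infty_natSinv_lt (PosNum e0).
have /andP[h1 h2] := smooth_ppart_itv n s.
rewrite ger0_norm ?subr_ge0// lerBlDr -lerBlDl (le_trans _ h1)// lerD2l lerN2.
exact: ltW.
Unshelve. all: by end_near. Qed.

Lemma cvg_smooth_ppart' s : smooth_ppart' n s @[n --> \oo] --> ((0 < s)%R%:R : R).
Proof.
apply: (@cvg_near_cst _ (R^o : normedModType R)).
have [s0|s0] := ltP 0 s; near=> n; rewrite /smooth_ppart' /ppart.
  have ne : (n.+1%:R)^-1 < s by near: n; exact: near_infty_natSinv_lt (PosNum s0).
  rewrite (max_l (ltW s0)) max_l; last by rewrite subr_ge0 ltW.
  by rewrite opprB addrCA subrr addr0 divff// gt_eqF.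
have e0 : (0 : R) < n.+1%:R^-1 by rewrite invr_gt0.
rewrite (max_r s0) max_r ?subrr ?mulr0// subr_le0.
by rewrite (le_trans s0)// ltW.
Unshelve. all: by end_near. Qed.

End positive_part.

Section weak_gradient_positive_part.
Context {R : realType} {d : nat}.
Notation mu := (lebesgue_rV R d).
Variables (y : 'rV[R]_d) (r0 : R) (i : 'I_d) (f g : 'rV[R]_d -> R) (kappa : R).
Hypotheses (r0_gt0 : 0 < r0) (If : L1 mu f) (Lf : L2 mu f) (Lg : L2 mu g).
Hypothesis fg : weak_partial (eball y r0) i f g.
Notation B := (eball y r0).

Lemma measurable_ppart : measurable_fun setT (@ppart R).
Proof. by apply: measurable_maxr. Qed.

(** The chain rule for [smooth_ppart n], then dominated convergence in [L^2] of
    the functions and of their derivatives. *)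
Lemma weak_partial_ppart :
  weak_partial B i (fun x => \1_B x * ppart (f x - kappa))
    (fun x => (kappa < f x)%R%:R * g x).
Proof.
have mB := measurable_eball y r0.
have mf : measurable_fun setT f by exact: L2_measurable Lf.
have mg : measurable_fun setT g by exact: L2_measurable Lg.
have mp := measurable_ppart.
have mi : measurable_fun setT (\1_B : _ -> R) by exact: measurable_indic.
pose bound x := \1_B x * (f x - kappa).
have Lb : L2 mu bound.
  have L1B : L2 mu (fun x => kappa * \1_B x).
    by apply/L2Z/L2_indic => //; exact: eball_finite.
  have := L2B (L2_restrict mB Lf) L1B.
  by congr (L2 mu); apply/funext => x; rewrite /bound mulrBr (mulrC kappa).
pose v n x := \1_B x * smooth_ppart n (f x - kappa).
pose b' n x := smooth_ppart' n (f x - kappa).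
have ms n : measurable_fun setT (@smooth_ppart R n).
  apply: measurable_funM => //; apply: measurable_funB; apply: measurable_funX => //.
  by apply: measurableT_comp => //; exact: measurable_funB.
have ms' n : measurable_fun setT (@smooth_ppart' R n).
  apply: measurable_funM => //; apply: measurable_funB => //.
  by apply: measurableT_comp => //; exact: measurable_funB.
have mfk : measurable_fun setT (fun x => f x - kappa) by exact: measurable_funB.
have mv n : measurable_fun setT (v n).
  by apply: measurable_funM => //; exact: measurableT_comp.
have vb n x : `|v n x| <= `|bound x|.
  rewrite /v /bound [leLHS]normrM [leRHS]normrM ler_wpM2l// (ger0_norm (smooth_ppart_ge0 _ _)).
  have /andP[_ h] := smooth_ppart_itv n (f x - kappa); apply: le_trans h _.
  by rewrite /ppart ge_max ler_norm normr_ge0.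
have Lv n : L2 mu (v n) by exact: L2_le Lb (vb n).
have Iv n : L1 mu (v n).
  rewrite (_ : v n = fun x => \1_B x * v n x); first exact: indic_eball_L1.
  apply/funext => x; rewrite /v indicE.
  by case: (_ \in _); rewrite ?mul1r ?mul0r.
have chain n : weak_partial B i (v n) (fun x => b' n x * g x).
  apply: (@weak_partial_chain _ _ y r0 i f g r0_gt0 If Lf Lg fg
    (fun a => smooth_ppart n (a - kappa)) (fun a => smooth_ppart' n (a - kappa))
    n.+1%:R) => //.
  - by apply: measurableT_comp => //; exact: measurable_funB.
  - by move=> a; have /andP[h1 h2] := smooth_ppart'_itv n (a - kappa); rewrite ger0_norm.
  - move=> a b; have := smooth_ppart_taylor n (a - kappa) (b - kappa).
    by rewrite (_ : b - kappa - (a - kappa) = b - a)//; ring.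
  - exact: Iv.
  - exact: Lv.
pose w x := \1_B x * ppart (f x - kappa).
have mw : measurable_fun setT w by apply: measurable_funM => //; exact: measurableT_comp.
have [Lw cw] : L2 mu w /\ nsq mu (fun x => v n x - w x) @[n --> \oo] --> 0.
  apply: (nsq_dominated mv mw Lb vb) => x.
  by apply: cvgM; [exact: cvg_cst|exact: cvg_smooth_ppart].
pose G x := (kappa < f x)%R%:R * g x.
have mG_ : forall k, measurable_fun setT (fun x => b' k x * g x).
  move=> k.
  by apply: measurable_funM => //; exact: measurableT_comp.
have cG_ x : b' n x * g x @[n --> \oo] --> G x.
  apply: cvgM; last exact: cvg_cst.
  by rewrite -subr_gt0; exact: cvg_smooth_ppart'.
have bG (k : nat) x : `|b' k x * g x| <= `|g x|.
  have /andP[h1 h2] := smooth_ppart'_itv k (f x - kappa).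
  by rewrite normrM ler_piMl// ger0_norm.
have mG : measurable_fun setT G.
  by apply: (measurable_fun_cvg mG_) => x _; exact: cG_.
have [LG cG] : L2 mu G /\ nsq mu (fun x => b' n x * g x - G x) @[n --> \oo] --> 0.
  exact: (nsq_dominated mG_ mG Lg bG cG_).
move=> phi tphi.
have c1 := ip_cvg Lv Lw (test_function_partial_L2 i tphi) cw.
have c2 := ip_cvg (fun n => L2_le (mG_ n) Lg (bG n)) LG (test_function_L2 tphi) cG.
have c3 : ip mu (v n) (partial i phi) @[n --> \oo] --> - ip mu G phi.
  under eq_fun do rewrite (chain _ _ tphi).
  exact: cvgN.
by rewrite -(cvg_lim _ c1)// -(cvg_lim _ c3).
Qed.

End weak_gradient_positive_part.

(** * Averaging over translations *)

Section averaging.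
Context {R : realType} {d : nat}.
Notation mu := (lebesgue_rV R d).
Implicit Types (w : 'rV[R]_d -> R) (x y z : 'rV[R]_d) (B : set 'rV[R]_d).

(** The corners of the coordinate path from 0 to [y]. *)
Definition head_coords (k : nat) y : 'rV[R]_d :=
  \row_(j < d) (if (j < k)%N then y ord0 j else 0).

Lemma head_coords0 y : head_coords 0 y = 0.
Proof. by apply/rowP => j; rewrite !mxE. Qed.

Lemma head_coords_full y : head_coords d y = y.
Proof. by apply/rowP => j; rewrite !mxE ltn_ord. Qed.

Lemma head_coordsS (k : 'I_d) y :
  head_coords k.+1 y = head_coords k y + y ord0 k *: evec k.
Proof.
apply/rowP => j; rewrite !mxE eqxx /= ltnS leq_eqVlt.
have [->|jk] := eqVneq j k; first by rewrite eqxx ltnn mulr1 add0r.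
by rewrite (_ : (j == k :> nat) = false) ?mulr0 ?addr0//; apply/negbTE.
Qed.

Section translation_by_vector.
Variables (B : set 'rV[R]_d) (w : 'rV[R]_d -> R) (G : 'I_d -> 'rV[R]_d -> R).
Variables (r rho t : R).
Hypotheses (r0 : 0 < r) (t0 : 0 <= t) (rt : r + d%:R * t <= rho).
Hypotheses (Iw : L1 mu w) (Lw : L2 mu w) (LG : forall i, L2 mu (G i)).
Hypothesis wG : forall i, weak_partial B i w (G i).
Hypothesis rhoB : eball 0 rho `<=` B.
Let S := \sum_(i < d) nsq mu (fun x => \1_(eball 0 rho) x * G i x).

Lemma eucl_norm_cube y : (forall i, 0 <= y ord0 i <= t) -> eucl_norm y <= d%:R * t.
Proof.
move=> yt; rewrite (le_trans (eucl_norm_le_sum _))//.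
apply: (@le_trans _ _ (\sum_(i < d) t)).
  by apply: ler_sum => i _; have /andP[h1 h2] := yt i; rewrite ger0_norm.
by rewrite sumr_const card_ord mulr_natl.
Qed.

(** Moving along the coordinates one at a time, each step being controlled by
    [translation_estimate] on a translated ball; the powers of 4 absorb the
    factor 2 that [nsqD_le] loses at each step. *)
Lemma nsq_translate_cube y : (forall i, 0 <= y ord0 i <= t) ->
  nsq mu (fun x => \1_(eball 0 r) x * (w (x + y) - w x)) <= 4 ^+ d * t ^+ 2 * S.
Proof.
move=> yt.
have S0 : 0 <= S by apply: sumr_ge0 => i _; exact: nsq_ge0.
have mE z s := @measurable_eball R d z s.
have main k : (k <= d)%N ->
  nsq mu (fun x => \1_(eball 0 r) x * (w (x + head_coords k y) - w x)) <=
  (4 ^+ k - 1) * (t ^+ 2 * S).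
  elim: k => [_|k IH kd].
    rewrite expr0 subrr mul0r nsqE; under eq_Rintegral.
      by move=> x _; rewrite head_coords0 addr0 subrr mulr0 expr0n; over.
    by rewrite /Rintegral integral0.
  pose k' := Ordinal kd; pose yk := head_coords k y.
  rewrite (_ : (fun x => _) = (fun x =>
    \1_(eball 0 r) x * (w (x + yk) - w x) +
    \1_(eball 0 r) x * (w (x + yk + y ord0 k' *: evec k') - w (x + yk)))); last first.
    by apply/funext => x; rewrite (head_coordsS k') -/yk addrA; ring.
  have Lk : L2 mu (fun x => w (x + yk)) by exact: L2_shift.
  have Lk' : L2 mu (fun x => w (x + yk + y ord0 k' *: evec k')).
    by apply: (L2_shift yk (f := fun z => w (z + y ord0 k' *: evec k'))); exact: L2_shift.
  have La : L2 mu (fun x => \1_(eball 0 r) x * (w (x + yk) - w x)).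
    by apply: L2_restrict => //; exact: L2B.
  have Lb : L2 mu (fun x => \1_(eball 0 r) x *
      (w (x + yk + y ord0 k' *: evec k') - w (x + yk))).
    by apply: L2_restrict => //; exact: L2B.
  apply: (le_trans (nsqD_le La Lb)).
  have h1 := IH (ltnW kd); rewrite -/yk in h1.
  have h2 : nsq mu (fun x => \1_(eball 0 r) x *
      (w (x + yk + y ord0 k' *: evec k') - w (x + yk))) <= t ^+ 2 * S.
    have /andP[y0 y1] := yt k'.
    have ykt s : 0 <= s <= y ord0 k' -> eball (yk + s *: evec k') r `<=` eball 0 rho.
      move=> /andP[s0 s1]; apply: sub_eball; rewrite subr0 addrC.
      apply: le_trans rt; rewrite lerD2l; apply: eucl_norm_cube => j.
      rewrite !mxE eqxx /=; have /andP[j0 j1] := yt j.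
      have [->|jk] := eqVneq j k'; first by rewrite ltnn mulr1 add0r s0 (le_trans s1).
      by rewrite mulr0 addr0; case: ifP => _; rewrite ?j0 ?j1 ?lexx.
    have := translation_estimate r0 y0 (mE 0 rho) Iw Lw (LG k') (wG k') rhoB ykt.
    have -> : nsq mu (fun x => \1_(eball 0 r) x *
        (w (x + yk + y ord0 k' *: evec k') - w (x + yk))) =
      nsq mu (fun x => \1_(eball yk r) x * (w (x + y ord0 k' *: evec k') - w x)).
      rewrite /nsq -[RHS](ip_shift yk).
      - apply: eq_Rintegral => x _; rewrite !indicE.
        by rewrite (_ : (x + yk \in eball yk r) = (x \in eball 0 r))// /eball; apply: asbool_equiv_eq; rewrite /= addrK subr0.
      - by apply: L2_restrict => //; apply: L2B => //; exact: L2_shift.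
      - by apply: L2_restrict => //; apply: L2B => //; exact: L2_shift.
    move=> /le_trans; apply.
    apply: ler_pM; [exact: sqr_ge0|exact: nsq_ge0|by rewrite lerXn2r ?nnegrE|].
    rewrite /S (bigD1 k')//= lerDl; apply: sumr_ge0 => i _; exact: nsq_ge0.
  have tS : 0 <= t ^+ 2 * S by rewrite mulr_ge0 ?sqr_ge0.
  have : (1 : R) <= 4 ^+ k by rewrite exprn_ege1//; lra.
  move: h1 h2 tS; rewrite (exprS 4 k); set q := 4 ^+ k; set T := t ^+ 2 * S.
  move=> h1 h2 tS q1; have qT : T <= q * T by exact: ler_peMl.
  lra.
have := main d (leqnn d); rewrite head_coords_full => /le_trans; apply.
have tS : 0 <= t ^+ 2 * S by rewrite mulr_ge0 ?sqr_ge0.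
by rewrite -mulrA ler_wpM2r//; lra.
Qed.

End translation_by_vector.
End averaging.

Section averaging_estimate.
Context {R : realType} {d : nat}.
Notation mu := (lebesgue_rV R d).
Implicit Types (a b w : 'rV[R]_d -> R) (x y z : 'rV[R]_d).

Definition cube (t : R) : set 'rV[R]_d := [set y | forall i, 0 <= y ord0 i <= t].

Lemma measurable_cube t : measurable (cube t).
Proof.
rewrite (_ : cube t = [set x | forall i, `[0, t]%classic (x ord0 i)]).
  by apply: (@measurable_box _ _ (fun=> `[0, t]%classic)).
by apply/seteqP; split => x /= h i; have := h i; rewrite /= in_itv/=.
Qed.

Lemma lebesgue_rV_cube t : 0 <= t -> mu (cube t) = (t ^+ d)%:E.
Proof.
move=> t0; rewrite -[LHS]/(mu [set x : 'rV[R]_d | forall i, `[0, t]%classic (x ord0 i)]).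
rewrite (lebesgue_rV_box (A := fun i => `[0, t]%classic))//.
rewrite (eq_bigr (fun=> t%:E)); last first.
  move=> i _; rewrite lebesgue_measure_itv/= lte_fin oppr0 addr0.
  by move: t0; rewrite le_eqVlt => /orP[/eqP <-|->//]; rewrite ltxx.
by rewrite prodEFin prodr_const card_ord.
Qed.

Lemma measurable_addp : measurable_fun setT (fun p : 'rV[R]_d * 'rV[R]_d => p.1 + p.2).
Proof.
apply: measurable_fun_coordP => i; under eq_fun do rewrite mxE.
apply: measurable_funD.
  exact: measurableT_comp (measurable_coord i) measurable_fst.
exact: measurableT_comp (measurable_coord i) measurable_snd.
Qed.

(** By Tonelli and, in the inner integral, translation invariance; measurability
    in [y] comes with Tonelli's theorem. *)
Lemma integral_correlation a b : (forall x, 0 <= a x) -> (forall x, 0 <= b x) ->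
  L1 mu a -> L1 mu b ->
  (\int[mu]_y \int[mu]_x (a x * b (x + y)%R)%:E =
    ((\int[mu]_x a x) * (\int[mu]_x b x))%:E)%E /\
  measurable_fun setT (fun y => \int[mu]_x (a x * b (x + y)%R)%:E)%E.
Proof.
move=> a0 b0 Ia Ib.
have ma := L1_measurable Ia; have mb := L1_measurable Ib.
pose f (p : 'rV[R]_d * 'rV[R]_d) := (a p.1 * b (p.1 + p.2))%:E.
have mf : measurable_fun setT f.
  apply/measurable_EFinP; apply: measurable_funM.
    exact: measurableT_comp ma measurable_fst.
  exact: measurableT_comp mb measurable_addp.
have f0 p : (0 <= f p)%E by rewrite lee_fin mulr_ge0.
split; last first.
  have H : measurable_fun setT (fubini_G mu f) by apply: measurable_fun_fubini_tonelli_G.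
  by rewrite /fubini_G /f /= in H.
rewrite -(fubini_tonelli (m1 := mu) (m2 := mu) f mf f0) /f /=.
have fa : (\int[mu]_x (a x)%:E)%E \is a fin_num by exact: integrable_fin_num.
have fb : (\int[mu]_x (b x)%:E)%E \is a fin_num by exact: integrable_fin_num.
transitivity (\int[mu]_x ((a x)%:E * \int[mu]_x (b x)%:E))%E.
  apply: eq_integral => x _.
  under eq_integral do rewrite EFinM.
  rewrite ge0_integralZl_EFin//.
  - congr (_ * _)%E; under eq_integral do rewrite addrC.
    rewrite (ge0_integral_shift x (f := fun z => (b z)%:E))//.
    exact/measurable_EFinP.
  - by move=> y _; rewrite lee_fin.
  - apply/measurable_EFinP; apply: measurableT_comp => //.
    rewrite (_ : +%R x = fun y => y + x); first exact: measurable_shift.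
    by apply/funext => y; rewrite addrC.
rewrite ge0_integralZr//.
- by rewrite EFinM /Rintegral !fineK.
- exact/measurable_EFinP.
- by move=> x _; rewrite lee_fin.
- by apply: integral_ge0 => x _; rewrite lee_fin.
Qed.

(** For [y] in the cube, integrating [w^2 <= (w(. + y) - w)^2 + 2 w w(. + y)]
    over the ball leaves a correlation of [w] with its translate, whose
    integral over all [y] is a product of integrals of [w]. *)
Lemma averaging_estimate w (r rho t K : R) : 0 <= t -> r + d%:R * t <= rho ->
  L2 mu w -> (forall x, 0 <= w x) ->
  (forall y, cube t y ->
    nsq mu (fun x => \1_(eball 0 r) x * (w (x + y) - w x)) <= K) ->
  t ^+ d * nsq mu (fun x => \1_(eball 0 r) x * w x) <=
  t ^+ d * K + 2 * (\int[mu]_x (\1_(eball 0 rho) x * w x)) ^+ 2.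
Proof.
move=> t0 rt Lw w0 HK.
have mE z s := @measurable_eball R d z s.
pose a x := \1_(eball 0 r) x * w x; pose b x := \1_(eball 0 rho) x * w x.
have LE s := @indic_eball_L2 R d 0 s.
have La : L2 mu a by exact: L2_restrict.
have Lb : L2 mu b by exact: L2_restrict.
have Ia : L1 mu a by exact: L2_L1M.
have Ib : L1 mu b by exact: L2_L1M.
have a0 x : 0 <= a x by rewrite mulr_ge0.
have b0 x : 0 <= b x by rewrite mulr_ge0.
have rrho : r <= rho.
  by apply: le_trans rt; rewrite lerDl mulr_ge0.
have ab x : a x <= b x.
  rewrite /a /b !indicE; have [xr|xr] := pselect (eball 0 r x); last first.
    by rewrite memNset// mul0r mulr_ge0.
  by rewrite !mem_set//; apply: lt_le_trans rrho.
have [cE mc] := integral_correlation a0 b0 Ia Ib.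
set I := \int[mu]_x (\1_(eball 0 rho) x * w x).
have I0 : 0 <= I by apply: Rintegral_ge0 => x _; exact: b0.
have Iab : (\int[mu]_x a x) * (\int[mu]_x b x) <= I ^+ 2.
  have aI : \int[mu]_x a x <= I by exact: le_Rintegral.
  have -> : \int[mu]_x b x = I by [].
  by rewrite expr2 ler_wpM2r.
have IJ y : L1 mu (fun x => a x * b (x + y)) by apply: L2_L1M => //; exact: L2_shift.
have key y : cube t y -> nsq mu a - K <= 2 * \int[mu]_x (a x * b (x + y)).
  move=> ty; rewrite lerBlDr -lerBlDl; apply: le_trans (HK y ty).
  have L3 : L2 mu (fun x => \1_(eball 0 r) x * (w (x + y) - w x)).
    by apply: L2_restrict => //; apply: L2B => //; exact: L2_shift.
  have Ja : \int[mu]_x (2 * (a x * b (x + y))) = 2 * \int[mu]_x (a x * b (x + y)).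
    by apply: RintegralZl => //; exact: IJ.
  have Jb := L1Z 2 (IJ y).
  rewrite !nsqE -Ja -RintegralB//; last by case: La.
  apply: le_Rintegral => //.
  - by apply: L1B; [case: La|exact: (L1Z 2 (IJ y))].
  - by case: L3.
  - move=> x _; rewrite /a /b; have [xr|xr] := pselect (eball 0 r x); last first.
      by rewrite indicE memNset// !mul0r expr0n/= mulr0 subr0.
    have xy : eball 0 rho (x + y).
      apply: lt_le_trans rt; rewrite /= subr0 (le_lt_trans (ler_eucl_normD _ _))//.
      have yt := eucl_norm_cube ty.
      by move: xr; rewrite /eball/= subr0 => xr; lra.
    rewrite !indicE !mem_set// !mul1r.
    by have := sqr_ge0 (w (x + y)); nra.
have [D0|D0] := leP (nsq mu a - K) 0.
  rewrite -/a; have : t ^+ d * (nsq mu a - K) <= 0 by rewrite mulr_ge0_le0// exprn_ge0.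
  by have := sqr_ge0 I; rewrite mulrBr; lra.
suff : (((nsq mu a - K) * t ^+ d)%:E <= (2 * I ^+ 2)%:E)%E.
  by rewrite lee_fin -/a mulrBl; lra.
rewrite [leLHS]EFinM -lebesgue_rV_cube// -integral_cst; last exact: measurable_cube.
apply: (@le_trans _ _ (\int[mu]_(y in cube t) (2%:E * \int[mu]_x (a x * b (x + y)%R)%:E))%E).
  apply: ge0_le_integral => //.
  - exact: measurable_cube.
  - by move=> y _; rewrite lee_fin ltW.
  - by apply: measurable_funTS; exact: measurable_funeM.
  - move=> y ty; have fJ := integrable_fin_num measurableT (IJ y).
    by rewrite -(fineK fJ) -EFinM lee_fin; exact: key.
apply: (@le_trans _ _ (\int[mu]_y (2%:E * \int[mu]_x (a x * b (x + y)%R)%:E))%E).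
  apply: ge0_subset_integral => //; first exact: measurable_cube.
    exact: measurable_funeM.
  move=> y _; rewrite mule_ge0// integral_ge0// => x _; rewrite lee_fin mulr_ge0//.
rewrite ge0_integralZl_EFin//.
- by rewrite cE -EFinM lee_fin ler_pM2l.
- by move=> y _; apply: integral_ge0 => x _; rewrite lee_fin mulr_ge0.
Qed.

End averaging_estimate.

(** * The De Giorgi iteration *)

Section iteration.
Context {R : realType} {d : nat}.
Notation mu := (lebesgue_rV R d).
Notation B := (eball (0 : 'rV[R]_d) 1).
Implicit Types (u S : 'rV[R]_d -> R) (kappa : R).

Definition trunc u kappa (x : 'rV[R]_d) : R := \1_B x * ppart (u x - kappa).

Definition excess u (r kappa : R) : R :=
  nsq mu (fun x => \1_(eball 0 r) x * trunc u kappa x).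

(** The inequality of the De Giorgi class on concentric balls, with [S] replaced
    by a bound [M] and with the existence of the weak gradient of the
    truncation included. *)
Definition energy_inequality (C M : R) u := forall kappa (r rho : R),
  0 < r < rho -> rho <= 1 -> exists G : 'I_d -> 'rV[R]_d -> R,
  [/\ forall i, L2 mu (G i),
      forall i, weak_partial B i (trunc u kappa) (G i) &
      \sum_(i < d) nsq mu (fun x => \1_(eball 0 r) x * G i x) <=
      C / (rho - r) ^+ 2 * excess u rho kappa +
      C * M * \int[mu]_x (\1_(eball 0 rho) x * trunc u kappa x)].

Lemma ppart_ge0 (s : R) : 0 <= ppart s.
Proof. by rewrite le_max lexx orbT. Qed.

Lemma trunc_ge0 u kappa x : 0 <= trunc u kappa x.
Proof. by rewrite mulr_ge0// ppart_ge0. Qed.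

Lemma trunc_L2 u kappa : L2 mu u -> L2 mu (trunc u kappa).
Proof.
move=> Lu; have mB := @measurable_eball R d 0 1.
have Lb : L2 mu (fun x => \1_B x * u x - kappa * \1_B x).
  apply: L2B; first exact: L2_restrict.
  by apply/L2Z/L2_indic => //; exact: eball_finite.
have mu' : measurable_fun setT (fun x => u x - kappa).
  by apply: measurable_funB => //; exact: L2_measurable Lu.
apply: L2_le Lb _.
  apply: measurable_funM; first exact: measurable_indic.
  exact: measurableT_comp measurable_ppart mu'.
move=> x; rewrite (mulrC kappa) -mulrBr /trunc [leLHS]normrM [leRHS]normrM.
by rewrite ler_wpM2l// (ger0_norm (ppart_ge0 _)) ge_max ler_norm normr_ge0.
Qed.

Lemma trunc_L1 u kappa : L2 mu u -> L1 mu (trunc u kappa).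
Proof.
move=> Lu; have := indic_eball_L1 0 1 (trunc_L2 kappa Lu).
congr (L1 mu); apply/funext => x; rewrite /trunc indicE.
by case: (_ \in _); rewrite ?mul1r ?mul0r.
Qed.

Lemma indic_eball_le (r rho : R) (x : 'rV[R]_d) : r <= rho ->
  (\1_(eball 0 r) x : R) <= \1_(eball 0 rho) x.
Proof.
move=> rrho; rewrite !indicE; have [xr|xr] := pselect (eball 0 r x).
  by rewrite !mem_set//; exact: lt_le_trans rrho.
by rewrite memNset.
Qed.

Lemma indic_ge0 (A : set 'rV[R]_d) x : 0 <= (\1_A x : R).
Proof. by rewrite indicE. Qed.

Lemma indic_idem (A : set 'rV[R]_d) x : (\1_A x : R) * \1_A x = \1_A x.
Proof. by rewrite indicE; case: (_ \in _); rewrite ?mul1r ?mul0r. Qed.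

Lemma trunc_le u (kappa kappa' : R) x : kappa <= kappa' ->
  trunc u kappa' x <= trunc u kappa x.
Proof.
move=> kk; rewrite ler_wpM2l ?indic_ge0//.
by rewrite /ppart ge_max !le_max lexx orbT andbT lerB.
Qed.

(** Above the higher level the lower truncation exceeds the gap [m], so the
    higher truncation is controlled by the square of the lower one. *)
Lemma trunc_le_sqr u kappa (m : R) x : 0 < m ->
  m * trunc u (kappa + m) x <= trunc u kappa x ^+ 2.
Proof.
move=> m0; rewrite /trunc exprMn expr2 indic_idem mulrCA ler_wpM2l ?indic_ge0//.
rewrite /ppart; case: (lerP (u x - (kappa + m)) 0) => h1.
  by rewrite mulr0 sqr_ge0.
by case: (lerP (u x - kappa) 0) => h2; nra.
Qed.

Lemma excess_le u (r rho kappa kappa' : R) : L2 mu u -> r <= rho -> kappa <= kappa' ->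
  excess u r kappa' <= excess u rho kappa.
Proof.
move=> Lu rrho kk; have mE s := @measurable_eball R d 0 s.
apply: le_nsq; [exact: L2_restrict (trunc_L2 _ Lu)|exact: L2_restrict (trunc_L2 _ Lu)|].
move=> x; rewrite [leLHS]normrM [leRHS]normrM !(ger0_norm (indic_ge0 _ _)) !(ger0_norm (trunc_ge0 _ _ _)).
by rewrite ler_pM ?indic_ge0 ?trunc_ge0// ?indic_eball_le// trunc_le.
Qed.

Lemma integral_trunc_le u (rho kappa m : R) : L2 mu u -> 0 < m ->
  m * \int[mu]_x (\1_(eball 0 rho) x * trunc u (kappa + m) x) <= excess u rho kappa.
Proof.
move=> Lu m0; have I1 := indic_eball_L1 0 rho (trunc_L2 (kappa + m) Lu).
have [_ I2] : L2 mu (fun x => \1_(eball 0 rho) x * trunc u kappa x).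
  by apply: L2_restrict; [exact: measurable_eball|exact: trunc_L2].
rewrite /excess nsqE -RintegralZl//; apply: le_Rintegral => //; first exact: L1Z.
move=> x _; rewrite exprMn expr2 indic_idem mulrCA ler_wpM2l ?indic_ge0//.
exact: trunc_le_sqr.
Qed.

Section step.
Variables (C M : R) (u : 'rV[R]_d -> R).
Hypotheses (C0 : 0 <= C) (M0 : 0 <= M) (Lu : L2 mu u) (EI : energy_inequality C M u).

(** One step of the iteration, from the ball of radius [r + 2 delta] and the
    level [kappa] to the ball of radius [r] and the level [kappa + m]: the
    energy inequality is used on the outer shell of width [delta], the
    averaging estimate on the inner one. *)
Lemma excess_step (r delta t kappa m : R) : 0 < r -> 0 < delta -> 0 < m -> 0 < t ->
  r + delta + delta <= 1 -> d%:R * t <= delta ->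
  t ^+ d * excess u r (kappa + m) <=
  t ^+ d * (4 ^+ d * t ^+ 2 * (C * (delta ^- 2 + M / m)) *
    excess u (r + delta + delta) kappa) +
  2 * (excess u (r + delta + delta) kappa / m) ^+ 2.
Proof.
move=> r0 delta0 m0 t0 rd dt.
set rho := r + delta; set R' := rho + delta; set k' := kappa + m.
have rrho : r < rho by rewrite ltrDl.
have rhoR : rho < R' by rewrite ltrDl.
have [|//|G [LG wG HG]] := EI k' (r := rho) (rho := R').
  by rewrite rhoR andbT (lt_trans r0).
set Y := excess u R' kappa.
have Y0 : 0 <= Y by exact: nsq_ge0.
have Yk : excess u R' k' <= Y by apply: excess_le; rewrite // lerDl ltW.
pose I' s := \int[mu]_x (\1_(eball 0 s) x * trunc u k' x).
have I'Y : I' R' <= Y / m.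
  by rewrite ler_pdivlMr// mulrC; exact: integral_trunc_le.
have I'rho : I' rho <= I' R'.
  apply: le_Rintegral => //; try exact: indic_eball_L1 _ _ (trunc_L2 _ Lu).
  by move=> x _; rewrite ler_wpM2r ?trunc_ge0// indic_eball_le// ltW.
have I'0 : 0 <= I' rho.
  by apply: Rintegral_ge0 => x _; rewrite mulr_ge0 ?indic_ge0 ?trunc_ge0.
have S1 : \sum_(i < d) nsq mu (fun x => \1_(eball 0 rho) x * G i x) <=
    C * (delta ^- 2 + M / m) * Y.
  apply: le_trans HG _; rewrite (_ : R' - rho = delta); last by rewrite /R'; ring.
  have h1 : C / delta ^+ 2 * excess u R' k' <= C / delta ^+ 2 * Y.
    by rewrite ler_wpM2l// divr_ge0// sqr_ge0.
  have h2 : C * M * I' R' <= C * M * (Y / m) by rewrite ler_wpM2l// mulr_ge0.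
  by rewrite (_ : C * _ * Y = C / delta ^+ 2 * Y + C * M * (Y / m)); [exact: lerD|ring].
have rhoB : eball 0 rho `<=` B.
  by apply: sub_eball; rewrite subrr eucl_norm0 add0r (le_trans (ltW rhoR)).
have rt : r + d%:R * t <= rho by rewrite lerD2l.
have Iw := trunc_L1 k' Lu; have Lw := trunc_L2 k' Lu.
have HK y (cy : cube t y) := nsq_translate_cube r0 (ltW t0) rt Iw Lw LG wG rhoB cy.
have := averaging_estimate (ltW t0) rt Lw (trunc_ge0 u k') HK.
rewrite -/(excess u r k') => /le_trans; apply; apply: lerD.
  by rewrite ler_wpM2l ?exprn_ge0 ?(ltW t0)// -[leRHS]mulrA ler_wpM2l// mulr_ge0 ?sqr_ge0// exprn_ge0.
rewrite ler_wpM2l// -/(I' rho) lerXn2r ?nnegrE//; last exact: le_trans I'Y.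
by rewrite divr_ge0// ltW.
Qed.

End step.
End iteration.

Section decay.
Context {R : realType} {d : nat}.
Notation mu := (lebesgue_rV R d).
Notation B := (eball (0 : 'rV[R]_d) 1).

(** The three constants of the iteration: at step [k] the excess is multiplied
    by [decay_ratio], and translations of size [decay_step C / 4 ^ k] are used.
    The power [4 ^ (d + 1)] compensates the growth of [t ^ - d] and of the
    squared inverse gap of the levels; [decay_step] makes the gradient term at
    most half of [decay_ratio], and [smallness] then does the same for the
    quadratic term. *)
Definition decay_ratio : R := (4 ^+ d.+1)^-1.
Definition decay_step (C : R) : R := decay_ratio / (516 * 4 ^+ d * C * d.+1%:R).
Definition smallness (C : R) : R := decay_step C ^+ d * decay_ratio / 16.

Lemma decay_ratio_gt0 : 0 < decay_ratio.
Proof. by rewrite invr_gt0 exprn_gt0. Qed.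

Lemma decay_ratio_le1 : decay_ratio <= 1.
Proof. by rewrite invf_le1 ?exprn_gt0// exprn_ege1// ler1n. Qed.

Section constants.
Variable C : R.
Hypothesis C1 : 1 <= C.

Let D0 : 0 < 516 * 4 ^+ d * C * d.+1%:R :> R.
Proof.
have C0 : 0 < C := lt_le_trans ltr01 C1.
have P0 : (0 : R) < 4 ^+ d by rewrite exprn_gt0.
apply: mulr_gt0; last by rewrite ltr0n.
apply: mulr_gt0 C0; apply: mulr_gt0 P0; by rewrite ltr0n.
Qed.

Lemma decay_step_gt0 : 0 < decay_step C.
Proof. by rewrite divr_gt0 ?decay_ratio_gt0. Qed.

Lemma smallness_gt0 : 0 < smallness C.
Proof.
by rewrite divr_gt0// mulr_gt0 ?decay_ratio_gt0// exprn_gt0// decay_step_gt0.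
Qed.

Let stepE : decay_step C * (516 * 4 ^+ d * C * d.+1%:R) = decay_ratio.
Proof. exact: (mulfVK (lt0r_neq0 D0)). Qed.

Lemma decay_step_le1 : d%:R * decay_step C <= 1 / 16.
Proof.
have := stepE; have := decay_ratio_le1; have := decay_step_gt0.
have P1 : (1 : R) <= 4 ^+ d by rewrite exprn_ege1// ler1n.
have P2 : 1 <= 4 ^+ d * C by rewrite mulr_ege1.
rewrite -addn1 natrD; set t := decay_step C; set q := decay_ratio => t0 q1.
set D := d%:R; have D0' : 0 <= D by [].
move=> E; have : t * (516 * (D + 1)) <= q.
  rewrite -E ler_wpM2l ?(ltW t0)//; have : D + 1 <= 4 ^+ d * C * (D + 1).
    by rewrite ler_peMl//; lra.
  lra.
nra.
Qed.

Lemma decay_step_small : 258 * 4 ^+ d * C * decay_step C ^+ 2 <= decay_ratio / 2.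
Proof.
have := stepE; have := decay_step_gt0.
have P1 : (1 : R) <= 4 ^+ d by rewrite exprn_ege1// ler1n.
have P2 : 1 <= 4 ^+ d * C by rewrite mulr_ege1.
have P3 : (1 : R) <= d.+1%:R by rewrite ler1n.
have P4 : 1 <= 4 ^+ d * C * d.+1%:R by rewrite mulr_ege1.
have := decay_ratio_le1; set t := decay_step C; set q := decay_ratio => q1 t0 E.
have t1 : t <= 1.
  have : t * 1 <= t * (4 ^+ d * C * d.+1%:R) by rewrite ler_wpM2l// ltW.
  have : t * (516 * 4 ^+ d * C * d.+1%:R) = 516 * (t * (4 ^+ d * C * d.+1%:R)) by ring.
  have : 0 <= t * (4 ^+ d * C * d.+1%:R) by rewrite mulr_ge0 ?(ltW t0)//; lra.
  lra.
have t2 : t ^+ 2 <= t by rewrite expr2 ler_piMl// ltW.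
have h1 : 4 ^+ d * C * t ^+ 2 <= 4 ^+ d * C * t by rewrite ler_wpM2l//; lra.
have h2 : 4 ^+ d * C * t <= 4 ^+ d * C * d.+1%:R * t.
  by rewrite -[leRHS]mulrA ler_wpM2l// ?ler_peMl ?(ltW t0)//; lra.
lra.
Qed.

End constants.

(** Induction on [k], with radii [3/4 + 2^-k / 4], levels [A (1 - 2^-k)] and
    translations of size [decay_step C * 4^-k]; writing [h = 2^-k], both shells
    have width [h / 16] and the gap of the levels is [A h / 2]. *)
Lemma excess_decay (C M A : R) (u : 'rV[R]_d -> R) : 1 <= C -> 0 <= M -> M <= A -> 0 < A ->
  L2 mu u -> energy_inequality C M u -> excess u 1 0 <= smallness C * A ^+ 2 ->
  forall k, excess u (3 / 4 + (2^-1) ^+ k / 4) (A * (1 - (2^-1) ^+ k)) <=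
    smallness C * A ^+ 2 * decay_ratio ^+ k.
Proof.
move=> C1 M0 MA A0 Lu EI Y0; elim=> [|k IH].
  by rewrite !expr0 subrr !mulr0 mulr1 (_ : 3 / 4 + 1 / 4 = 1)//; lra.
have C0 : 0 <= C by lra.
set h : R := 2^-1 ^+ k in IH *.
have h0 : 0 < h by rewrite exprn_gt0// invr_gt0.
have h1 : h <= 1 by rewrite exprn_ile1 ?invr_ge0// invf_le1//; lra.
have t00 := decay_step_gt0 C1; have q0 := decay_ratio_gt0.
have t1 := decay_step_le1 C1; have t2 := decay_step_small C1.
pose t := decay_step C * h ^+ 2.
have t0 : 0 < t by rewrite mulr_gt0// exprn_gt0.
have td0 : 0 < t ^+ d by rewrite exprn_gt0.
have hS : 2^-1 ^+ k.+1 = h / 2 by rewrite exprSr.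
have m0 : 0 < A * h / 2 by rewrite divr_gt0// mulr_gt0.
have r_gt0 : 0 < 3 / 4 + h / 8 by lra.
have delta0 : 0 < h / 16 by lra.
have hd1 : 3 / 4 + h / 8 + h / 16 + h / 16 <= 1 by lra.
have hh : h ^+ 2 <= h by rewrite expr2 ler_piMl// ltW.
have dt : d%:R * t <= h / 16.
  rewrite /t mulrA; apply: (@le_trans _ _ (1 / 16 * h ^+ 2)).
    by rewrite ler_wpM2r// sqr_ge0.
  lra.
have := excess_step C0 M0 Lu EI (A * (1 - h)) r_gt0 delta0 m0 t0 hd1 dt.
rewrite (_ : 3 / 4 + h / 8 + h / 16 + h / 16 = 3 / 4 + h / 4); last by field.
rewrite (_ : A * (1 - h) + A * h / 2 = A * (1 - 2^-1 ^+ k.+1)); last first.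
  by rewrite hS; field.
rewrite (_ : 3 / 4 + h / 8 = 3 / 4 + 2^-1 ^+ k.+1 / 4); last by rewrite hS; field.
set Y := excess u (3 / 4 + h / 4) _ in IH *; set Y' := excess u _ _ => main.
have Y0' : 0 <= Y by exact: nsq_ge0.
have hn0 : h != 0 by rewrite gt_eqF.
have An0 : A != 0 by rewrite gt_eqF.
(* the gradient term contributes at most half of the decay ratio: the shells
   give [256 / h ^ 2] and the source term at most [2 / h ^ 2] *)
have c1 : 4 ^+ d * t ^+ 2 * (C * ((h / 16) ^- 2 + M / (A * h / 2))) <= decay_ratio / 2.
  have e1 : (h / 16) ^- 2 + M / (A * h / 2) <= 258 / h ^+ 2.
    have i1 : M / (A * h / 2) <= 2 / h ^+ 2.
      rewrite ler_pdivrMr// (_ : 2 / h ^+ 2 * (A * h / 2) = A / h); last first.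
        by field; rewrite ?hn0 ?An0.
      rewrite ler_pdivlMr// (le_trans _ MA)// ler_piMr//.
    rewrite (_ : (h / 16) ^- 2 = 256 / h ^+ 2); last by field; rewrite ?hn0 ?An0.
    by rewrite (_ : 258 / h ^+ 2 = 256 / h ^+ 2 + 2 / h ^+ 2); [rewrite lerD2l|field].
  apply: (@le_trans _ _ (4 ^+ d * t ^+ 2 * (C * (258 / h ^+ 2)))).
    rewrite ler_wpM2l ?ler_wpM2l// mulr_ge0 ?exprn_ge0// ltW//.
  apply: le_trans t2.
  rewrite (_ : 4 ^+ d * t ^+ 2 * (C * (258 / h ^+ 2)) =
    258 * 4 ^+ d * C * decay_step C ^+ 2 * h ^+ 2); last by rewrite /t; field.
  have h21 : h ^+ 2 <= 1 by lra.
  have P0 : 0 <= 4 ^+ d * C * decay_step C ^+ 2.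
    by rewrite mulr_ge0 ?sqr_ge0// mulr_ge0// exprn_ge0.
  have -> : 258 * 4 ^+ d * C * decay_step C ^+ 2 = 258 * (4 ^+ d * C * decay_step C ^+ 2).
    by ring.
  rewrite -[leLHS]mulrA; apply: ler_wpM2l; first by rewrite ler0n.
  by rewrite ler_piMr.
(* so does the quadratic term, by the induction hypothesis and the choice of
   [smallness] *)
have c2 : 2 * (Y / (A * h / 2)) ^+ 2 <= t ^+ d * (decay_ratio / 2 * Y).
  rewrite (_ : 2 * (Y / (A * h / 2)) ^+ 2 = 8 * Y / (A ^+ 2 * h ^+ 2) * Y); last first.
    by field; rewrite An0 hn0.
  rewrite mulrA ler_wpM2r//.
  rewrite ler_pdivrMr; last by rewrite mulr_gt0// exprn_gt0.
  rewrite (le_trans (ler_wpM2l _ IH))//.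
  rewrite (_ : decay_ratio ^+ k = (h ^+ 2) ^+ d * h ^+ 2); last first.
    have -> : h ^+ 2 = 4^-1 ^+ k.
      by rewrite /h -exprM mulnC exprM; congr (_ ^+ _); field.
    by rewrite -exprSr /decay_ratio -exprVn -!exprM mulnC.
  rewrite /smallness /t [(decay_step C * _) ^+ d]exprMn.
  set X := (h ^+ 2) ^+ d; set T := decay_step C ^+ d.
  by rewrite le_eqVlt; apply/orP; left; apply/eqP; field.
have YY' : t ^+ d * Y' <= t ^+ d * (decay_ratio * Y).
  apply: le_trans main _.
  have : t ^+ d * (4 ^+ d * t ^+ 2 * (C * ((h / 16) ^- 2 + M / (A * h / 2))) * Y) <=
     t ^+ d * (decay_ratio / 2 * Y) by rewrite ler_wpM2l ?(ltW td0)// ler_wpM2r.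
  move=> i1; apply: le_trans (lerD i1 c2) _.
  by rewrite le_eqVlt; apply/orP; left; apply/eqP; field.
rewrite ler_pM2l// in YY'; apply: le_trans YY' _.
by rewrite (exprS decay_ratio k) mulrCA ler_wpM2l// ltW.
Qed.

End decay.

(** * Norms, weak gradients and the De Giorgi class *)

Section lebesgue_spaces.
Context {R : realType} {d : nat}.
Notation mu := (lebesgue_rV R d).
Implicit Types (f g u S : 'rV[R]_d -> R) (A B : set 'rV[R]_d).

(** Extensions by zero as products, the form in which they enter [ip]. *)
Lemma restrict_indic f A : f \_ A = (fun x => \1_A x * f x).
Proof. by rewrite patch_indic; apply/funext => x /=; rewrite mulrC. Qed.

Lemma in_L2P A f : in_Lp 2%:E A f <-> L2 mu (f \_ A).
Proof.
split=> [Lf|[mf If]].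
  split; last exact: Lfun2_integrable_sqr Lf.
  by move: Lf; rewrite /in_Lp inE => /andP[/set_mem].
rewrite /in_Lp inE /=; apply/andP; split; apply: mem_set => //=.
rewrite /finite_norm unlock.
rewrite poweR_lty//.
move/integrableP : If => [_]; apply: le_lt_trans.
rewrite le_eqVlt; apply/orP; left; apply/eqP; apply: eq_integral => x _ /=.
by rewrite powR_mulrn// normrX.
Qed.

Lemma Lp_norm2E A f : L2 mu (f \_ A) -> Lp_norm 2%:E A f = (Num.sqrt (nsq mu (f \_ A)))%:E.
Proof.
move=> [mf If]; rewrite /Lp_norm unlock.
have -> : (\int[mu]_x `|(EFin \o f \_ A) x| `^ 2)%E = (nsq mu (f \_ A))%:E.
  rewrite nsqE /Rintegral fineK; last exact: integrable_fin_num.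
  by apply: eq_integral => x _ /=; rewrite powR_mulrn// real_normK// num_real.
by rewrite poweR_EFin powR12_sqrt// nsq_ge0.
Qed.

Lemma Lp_normoo_le A f (M : R) : 0 <= M -> {ae mu, forall x, `|(f \_ A) x| <= M} ->
  (Lp_norm +oo A f <= M%:E)%E.
Proof.
move=> M0 fM; rewrite /Lp_norm unlock; case: ifP => _; last by rewrite lee_fin.
by apply/ess_supP; apply: filterS fM => x /=; rewrite lee_fin.
Qed.

Lemma in_Loo_bounded A f : in_Lp +oo A f -> exists2 M : R, 0 <= M &
  Lp_norm +oo A f = M%:E /\ {ae mu, forall x, `|(f \_ A) x| <= M}.
Proof.
rewrite /in_Lp inE => /andP[_ /set_mem/= fin].
have N0 : (0 <= Lp_norm +oo A f)%E by exact: Lnorm_ge0.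
have fN : (Lp_norm +oo A f) \is a fin_num by rewrite ge0_fin_numE.
exists (fine (Lp_norm +oo A f)); first exact: fine_ge0.
split; first by rewrite fineK.
have : Lp_norm +oo A f = (fine (Lp_norm +oo A f))%:E by rewrite fineK.
set M := fine _; rewrite /Lp_norm unlock; case: ifPn => [_ E|].
  have : (ess_sup mu (abse \o (EFin \o f \_ A)) <= M%:E)%E by rewrite E.
  by move=> /ess_supP; apply: filterS => x /=; rewrite lee_fin.
rewrite -leNgt => muT _; exists setT; split => //.
by apply/eqP; rewrite eq_le muT measure_ge0.
Qed.

Lemma nsq_eq0 f : L2 mu f -> nsq mu f <= 0 -> {ae mu, forall x, f x = 0}.
Proof.
move=> [mf If] f0.
have n0 : nsq mu f = 0 by apply/eqP; rewrite eq_le f0 nsq_ge0.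
have : (\int[mu]_x `|(f x ^+ 2)%:E|)%E = 0%E.
  have -> : (\int[mu]_x `|(f x ^+ 2)%:E|)%E = (\int[mu]_x (f x ^+ 2)%:E)%E.
    by apply: eq_integral => x _; rewrite gee0_abs// lee_fin sqr_ge0.
  rewrite -[LHS]fineK; last exact: (integrable_fin_num measurableT If).
  by rewrite -[fine _]/(Rintegral mu setT (fun x => f x ^+ 2)) -nsqE n0.
move/(ae_eq_integral_abs mu measurableT) => /(_ _)[].
  by apply/measurable_EFinP; exact: measurable_funX.
move=> N [mN N0 H]; exists N; split => // x /= fx; apply: H => /= /(_ Logic.I) [].
by move/eqP; rewrite sqrf_eq0 => /eqP.
Qed.

End lebesgue_spaces.

Section de_giorgi_class.
Context {R : realType} {d : nat}.
Notation mu := (lebesgue_rV R d).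
Notation B := (eball (0 : 'rV[R]_d) 1).
Implicit Types (f g u S : 'rV[R]_d -> R).

Lemma trunc_in_ball u kappa x : B x -> trunc (u \_ B) kappa x = (u \- cst kappa)^\+ x.
Proof.
by move=> Bx; rewrite /trunc restrict_indic indicE mem_set// !mul1r.
Qed.

Lemma restrict_trunc u kappa : (u \- cst kappa)^\+ \_ B = trunc (u \_ B) kappa.
Proof.
rewrite restrict_indic; apply/funext => x.
have [Bx|Bx] := pselect (B x); first by rewrite trunc_in_ball// indicE mem_set// mul1r.
by rewrite /trunc indicE memNset// !mul0r.
Qed.

Lemma weak_gradient_partial f G i : weak_gradient B f G ->
  weak_partial B i (f \_ B) (G i \_ B).
Proof.
move=> [_ fG] phi tphi.
have E g h : ip mu (g \_ B) h = fine (\int[mu]_(x in B) (g x * h x)%:E)%E.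
  rewrite -[RHS]/(Rintegral mu B (fun x => g x * h x)) Rintegral_mkcond.
  by apply: eq_Rintegral => x _; rewrite !restrict_indic mulrA.
by rewrite !E fG// fineN.
Qed.

Lemma weak_partial_gradient f (G : 'I_d -> 'rV[R]_d -> R) : L2 mu (f \_ B) ->
  (forall i, L2 mu (G i)) -> (forall i, weak_partial B i (f \_ B) (G i)) ->
  weak_gradient B f G.
Proof.
move=> Lf LG fG; split=> [i|i phi tphi].
  apply/in_L2P; rewrite restrict_indic; apply: L2_restrict => //.
  exact: measurable_eball.
have Lphi := test_function_L2 tphi; have Ldphi := test_function_partial_L2 i tphi.
have E1 : (\int[mu]_(x in B) (f x * partial i phi x)%:E)%E =
    (ip mu (f \_ B) (partial i phi))%:E.
  rewrite /ip /Rintegral fineK; last exact: (integrable_fin_num measurableT (L2_L1M Lf Ldphi)).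
  rewrite [LHS]integral_mkcond; apply: eq_integral => x _.
  by rewrite !patchE; case: ifP => // _; rewrite mul0r.
have E2 : (\int[mu]_(x in B) (G i x * phi x)%:E)%E = (ip mu (G i) phi)%:E.
  rewrite /ip /Rintegral fineK; last exact: (integrable_fin_num measurableT (L2_L1M (LG i) Lphi)).
  rewrite [LHS]integral_mkcond; apply: eq_integral => x _.
  rewrite !patchE; case: ifPn => // /negP xB.
  rewrite (test_function_out tphi) ?mulr0//.
  by move=> /mem_set.
by rewrite E1 E2 fG// EFinN.
Qed.

Lemma integral_sqr_indic A f : measurable A -> L2 mu (fun x => \1_A x * f x) ->
  (\int[mu]_(x in A) (f x ^+ 2)%:E = (nsq mu (fun x => \1_A x * f x))%:E)%E.
Proof.
move=> mA [_ If]; rewrite nsqE /Rintegral fineK; last exact: integrable_fin_num.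
rewrite [LHS]integral_mkcond; apply: eq_integral => x _.
by rewrite patchE indicE; case: ifP; rewrite ?mul1r// mul0r expr0n.
Qed.

(** The weak gradient of the truncation given by [weak_partial_ppart] is the one
    to which the inequality of the class is applied. *)
Lemma DG_plus_energy (C M : R) S u : 0 <= C -> 0 <= M ->
  {ae mu, forall x, `|(S \_ B) x| <= M} -> DG_plus C B S u ->
  L2 mu (u \_ B) /\ energy_inequality C M (u \_ B).
Proof.
move=> C0 M0 SM [/in_L2P LS [/in_L2P Lu [G0 uG0]] DG].
split=> // kappa r rho rrho rho1.
have mE s := @measurable_eball R d 0 s.
have Iu : L1 mu (u \_ B).
  have := indic_eball_L1 0 1 Lu; congr (L1 mu).
  by apply/funext => x; rewrite !restrict_indic mulrA indic_idem.
have LG0 i : L2 mu (G0 i \_ B) by apply/in_L2P; case: uG0.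
pose G i x := (kappa < (u \_ B) x)%R%:R * (G0 i \_ B) x.
have wG i : weak_partial B i (trunc (u \_ B) kappa) (G i).
  by apply: weak_partial_ppart => //; exact: weak_gradient_partial.
have LG i : L2 mu (G i).
  apply: L2Mb (LG0 i) _ _ => [|x]; last first.
    by instantiate (1 := 1); case: (_ < _)%R; rewrite ?normr1 ?normr0.
  have mu' : measurable_fun setT (u \_ B) := L2_measurable Lu.
  rewrite (_ : (fun x => _) = \1_((u \_ B) @^-1` `]kappa, +oo[)).
    by apply: measurable_indic; rewrite -[X in measurable X]setTI; exact: mu'.
  apply/funext => x; rewrite indicE; congr (nat_of_bool _)%:R.
  by apply/idP/idP => [h|/set_mem]; [apply: mem_set|]; rewrite /= in_itv/= andbT.
exists G; split => //.
have Lw := trunc_L2 kappa Lu.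
have gr : weak_gradient B (u \- cst kappa)^\+ G.
  by apply: weak_partial_gradient => //; rewrite restrict_trunc.
have rhoB : eball 0 rho `<=` B by apply: sub_eball; rewrite subrr eucl_norm0 add0r.
have rB : eball 0 r `<=` B.
  by apply: sub_eball; rewrite subrr eucl_norm0 add0r; move/andP: rrho => [_ /ltW/le_trans]; apply.
have := DG 0 rho rhoB kappa r rrho G gr.
have -> : (\int[mu]_(x in eball 0 r) (\sum_(i < d) G i x ^+ 2)%:E =
   (\sum_(i < d) nsq mu (fun x => \1_(eball 0 r) x * G i x))%:E)%E.
  under eq_integral do rewrite -sumEFin.
  rewrite ge0_integral_sum//.
  - rewrite -sumEFin; apply: eq_bigr => i _; apply: integral_sqr_indic => //.
    exact: L2_restrict.
  - move=> i; apply/measurable_EFinP; apply: measurable_funTS; apply: measurable_funX.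
    exact: L2_measurable (LG i).
  - by move=> i x _; rewrite lee_fin sqr_ge0.
have -> : (\int[mu]_(x in eball 0 rho) ((u \- cst kappa)^\+ x ^+ 2)%:E =
   (excess (u \_ B) rho kappa)%:E)%E.
  rewrite -integral_sqr_indic//; last exact: L2_restrict.
  by apply: eq_integral => x /set_mem /rhoB Bx; rewrite trunc_in_ball.
have h : (\int[mu]_(x in eball 0 rho) (`|S x| * (u \- cst kappa)^\+ x)%:E <=
   (M * \int[mu]_x (\1_(eball 0 rho) x * trunc (u \_ B) kappa x))%:E)%E.
  have mS : measurable_fun (eball 0 rho) (fun x => `|(S \_ B) x|).
    by apply: measurable_funTS; apply: measurableT_comp => //; exact: L2_measurable LS.
  have mw : measurable_fun (eball 0 rho) (trunc (u \_ B) kappa).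
    by apply: measurable_funTS; exact: L2_measurable Lw.
  have -> : (\int[mu]_(x in eball 0 rho) (`|S x| * (u \- cst kappa)^\+ x)%:E =
      \int[mu]_(x in eball 0 rho) (`|(S \_ B) x| * trunc (u \_ B) kappa x)%:E)%E.
    apply: eq_integral => x /set_mem /rhoB Bx.
    by rewrite trunc_in_ball// patchE mem_set.
  have -> : (M * \int[mu]_x (\1_(eball 0 rho) x * trunc (u \_ B) kappa x))%:E =
      (\int[mu]_(x in eball 0 rho) (M * trunc (u \_ B) kappa x)%:E)%E.
    have I1 := indic_eball_L1 0 rho Lw.
    rewrite -RintegralZl// /Rintegral fineK; last first.
      exact: (integrable_fin_num measurableT (L1Z M I1)).
    rewrite [RHS]integral_mkcond; apply: eq_integral => x _.
    by rewrite patchE indicE; case: ifP; rewrite ?mul1r// mul0r mulr0.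
  apply: ae_ge0_le_integral => //.
  - by move=> x _; rewrite lee_fin mulr_ge0// trunc_ge0.
  - by apply/measurable_EFinP; exact: measurable_funM.
  - by move=> x _; rewrite lee_fin mulr_ge0// trunc_ge0.
  - by apply/measurable_EFinP; exact: measurable_funM.
  - by apply: filterS SM => x Sx _; rewrite lee_fin ler_wpM2r// trunc_ge0.
move=> /le_trans => H.
rewrite -lee_fin; apply: H.
rewrite EFinD EFinM; apply: leeD => //.
by rewrite -mulrA EFinM lee_wpmul2l// lee_fin.
Qed.

End de_giorgi_class.

Unset Implicit Arguments.

Theorem proposition2p3p4 (R : realType) (d : nat) (hd : (1 <= d)%N)
    (CDG : R) (hCDG : 1 <= CDG) :
  exists2 C : R, 0 < C &
    forall S u : 'rV[R]_d -> R,
      in_Lp +oo%E (eball 0 1) S ->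
      DG_plus CDG (eball 0 1) S u ->
      (Lp_norm +oo (eball 0 (3 / 4)%R) u^\+%R <=
       C%:E * (Lp_norm 2%:E (eball 0 1%R) u^\+%R + Lp_norm +oo (eball 0 1%R) S))%E.
Proof.
pose eta : R := @smallness R d CDG.
have eta0 : 0 < eta by exact: smallness_gt0.
have se0 : 0 < (Num.sqrt eta)^-1 by rewrite invr_gt0 sqrtr_gt0.
exists ((Num.sqrt eta)^-1 + 1) => [|S u LS DG]; first by lra.
have [M M0 [SE SM]] := in_Loo_bounded LS.
have CDG0 : 0 <= CDG by lra.
have [Lu EI] := DG_plus_energy CDG0 M0 SM DG.
have upE : u^\+ = (u \- cst 0)^\+ by apply/funext => x; rewrite /funrpos /= subr0.
have Lup : L2 (lebesgue_rV R d) (u^\+ \_ (eball 0 1)).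
  by rewrite upE restrict_trunc; exact: trunc_L2.
rewrite SE (Lp_norm2E Lup) -EFinD -EFinM.
set N := Num.sqrt (nsq _ _); have N0 : 0 <= N by exact: sqrtr_ge0.
have Y0 : excess (u \_ (eball 0 1)) 1 0 = N ^+ 2.
  rewrite sqr_sqrtr ?nsq_ge0// upE restrict_trunc /excess.
  congr (nsq _ _); apply/funext => x.
  by rewrite /trunc mulrA indic_idem.
(* the margin [e] keeps the level [A] positive when [u^+] and [S] vanish *)
apply/lee_addgt0Pr => e e0.
pose A := N * (Num.sqrt eta)^-1 + M + e.
have NS0 : 0 <= N * (Num.sqrt eta)^-1 by rewrite mulr_ge0// ltW.
have A0 : 0 < A by rewrite /A; lra.
have MA : M <= A by rewrite /A; lra.
have Y0A : excess (u \_ (eball 0 1)) 1 0 <= eta * A ^+ 2.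
  have NE : N ^+ 2 = eta * (N * (Num.sqrt eta)^-1) ^+ 2.
    rewrite exprMn exprVn (sqr_sqrtr (ltW eta0)) mulrCA divff ?mulr1//.
    by rewrite gt_eqF.
  rewrite Y0 NE ler_pM2l// lerXn2r ?nnegrE ?(ltW A0)//.
  by rewrite /A; lra.
have decay := excess_decay hCDG M0 MA A0 Lu EI Y0A.
have excess0 : excess (u \_ (eball 0 1)) (3 / 4) A <= 0.
  have cq : eta * A ^+ 2 * decay_ratio (R := R) (d := d) ^+ k @[k --> \oo] --> (0 : R).
    rewrite -[X in _ --> X](mulr0 (eta * A ^+ 2)); apply: cvgM; first exact: cvg_cst.
    apply: cvg_expr; rewrite ger0_norm; last exact/ltW/decay_ratio_gt0.
    by rewrite invf_lt1 ?exprn_gt0// exprn_egt1// ltr1n.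
  apply: (ler_cvg_to (cvg_cst _) cq); apply: nearW => k.
  apply: le_trans (decay k); apply: excess_le => //.
    by rewrite lerDl divr_ge0// exprn_ge0// invr_ge0.
  by rewrite ler_piMr ?(ltW A0)// lerBlDr lerDl exprn_ge0// invr_ge0.
apply: (@le_trans _ _ A%:E); last first.
  rewrite -EFinD lee_fin /A; have : 0 <= (Num.sqrt eta)^-1 * M by rewrite mulr_ge0// ltW.
  lra.
have mE := @measurable_eball R d 0 (3 / 4).
apply: Lp_normoo_le; first exact: ltW.
have Lw := L2_restrict mE (trunc_L2 A Lu).
apply: filterS (nsq_eq0 Lw excess0) => x /=.
rewrite (restrict_indic u^\+) !indicE; case: (boolP (x \in _)) => [/set_mem x34|_]; last first.
  by rewrite !mul0r normr0 ltW.
have x1 : eball 0 1 x by apply: lt_le_trans x34 _; lra.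
rewrite !mul1r trunc_in_ball// => ux; rewrite ger0_norm; last by rewrite funrpos_ge0.
have : u x - A <= 0 by rewrite -ux /funrpos le_max lexx.
by rewrite subr_le0 /funrpos ge_max (ltW A0) andbT.
Qed.
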